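(* Let $\Phi=\{f_1,\dots,f_n\}$ be a $C^2$ IFS on $[0,1]$ as in the context, satisfying the separation property (S) and the non-integrability property (U), and let $\nu=\nu_{\mathbf p}$ be a self-conformal measure of $\Phi$ for a strictly positive probability vector $\mathbf p$. Then there exists a non-trivial Bernoulli model $\Sigma=\Sigma(\Phi,\nu)=\left((\Phi^{(i)})_{i\in I},(\mathbf p_i)_{i\in I},\mathbb{Q}\right)$, with each $\Phi^{(i)}$ consisting of maps from $\Phi$, such that: 1. (Disintegration of measure) $\nu=\int\mu_\omega\,d\mathbb{Q}(\omega)$. 2. (Disintegration of operator) For every $N\in\mathbb{N}$, $s\in\mathbb{C}$, $f\in C^1([0,1])$ and $x\in[0,1]$, $$P_s^N(f)(x)=\sum_{\omega\in I^N}\mathbb{Q}([\omega])\,P_{s,\omega,N}(f)(x),$$ where $[\omega]\subseteq\Omega$ is the cylinder set of sequences starting with $\omega$. 3. (Non-trivial branching) For every $i\in I$, $k_i=2$ or $k_i=3$. 4. (Separation) For every $\omega\in\Omega$ the union $\bigcup_{u\in X_1^{(\omega)}}f_u^{(\omega_1)}([0,1])$ is disjoint. 5. (UNI in all parts) There exist $m',m>0$ and $N_0\ge0$ such that for all $N\ge N_0$ and every $\omega\in\Omega$ there exist $\alpha_1^N,\alpha_2^N\in X_N^{(\omega)}$ with $$m\le\left|\frac{d}{dx}\left(\log|f_{\alpha_1^N}'|-\log|f_{\alpha_2^N}'|\right)(x)\right|\le m'\quad\text{for all }x\in[0,1].$$ 6. (Federer property) For every $D>1$ there exists $C_D=C_D(\Sigma)>0$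 such that for every $\omega\in\Omega$, every $x\in\operatorname{supp}(\mu_\omega)$ and every $r>0$, $\mu_\omega(B(x,Dr))\le C_D\,\mu_\omega(B(x,r))$.
   Context: $\Phi=\{f_1,\dots,f_n\}$ is a finite set of $C^2$ maps $f_a:[0,1]\to[0,1]$ with $0<\inf_{a,x}|f_a'(x)|\le\rho:=\sup_{a}\|f_a'\|_\infty<1$, such that not all $f_a$ have the same fixed point, and whose attractor $K$ does not contain $0$ or $1$. Write $\mathcal A=\{1,\dots,n\}$. For a finite composition $f_I$ of maps from $\Phi$, $c(I,x)=-\log|f_I'(x)|$. $\nu_{\mathbf p}$ is the unique Borel probability measure with $\nu=\sum_a p_a f_a\nu$. The transfer operator is $P_s(g)(x)=\sum_{a}p_a e^{2\pi s c(a,x)}g(f_a(x))$. Let $\tilde C$ denote a constant such that $\left|\frac{d}{dx}\log|f_w'|(x)\right|\le\tilde C$ for all finite words $w$ over $\mathcal A$ and all $x\in[0,1]$, where $f_w=f_{w_1}\circ\cdots\circ f_{w_m}$ (if $\sup_{f\in\Phi}\|f'\|_\infty<\frac12$, one may take $\tilde C=2\sup|f''/f'|$). (S) For every $1\le k\le n$ there is $i\in\{1,3\}$ such that $f_i([0,1])$, $f_{i+1}([0,1])$, $f_k([0,1])$ are pairwise disjoint; in particular $f_i([0,1])\cap f_{i+1}([0,1])=\emptyset$ for $i=1,3$. (U) There are $m,m'>0$ such that for $i=1,3$ and all $x\in[0,1]$, $m\le\left|\frac{d}{dx}\left(\log |f_i'|-\log|f_{i+1}'|\right)(x)\right|\le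 m'$, and moreover $m-2\tilde C\rho>0$. Models. Let $I$ be a finite index set, and for $i\in I$ let $\Phi^{(i)}=\{f_1^{(i)},\dots,f_{k_i}^{(i)}\}$ be a $C^2$ IFS and $\mathbf p_i=(p^{(i)}_1,\dots,p^{(i)}_{k_i})$ a strictly positive probability vector. Let $\Omega=I^{\mathbb N}$ with left shift $\sigma$. For $\omega\in\Omega$ and $N\in\mathbb{N}\cup\{\infty\}$ let $X_N^{(\omega)}=\prod_{j=1}^N\{1,\dots,k_{\omega_j}\}$; for $u\in X_N^{(\omega)}$ with $N<\infty$ put $f_u=f^{(\omega_1)}_{u_1}\circ\cdots\circ f^{(\omega_N)}_{u_N}$ and $\eta^{(\omega)}(u)=\prod_{j=1}^N p^{(\omega_j)}_{u_j}$. Let $\eta^{(\omega)}=\prod_{j\ge1}\mathbf p_{\omega_j}$ be the product measure on $X_\infty^{(\omega)}$, $\Pi_\omega(u)=\lim_{N\to\infty}f^{(\omega_1)}_{u_1}\circ\cdots\circ f^{(\omega_N)}_{u_N}(0)$, and $\mu_\omega=\Pi_\omega(\eta^{(\omega)})$ (push-forward). For $s\in\mathbb{C}$, $$P_{s,\omega,N}(g)(x)=\sum_{u\in X_N^{(\omega)}}\eta^{(\omega)}(u)\,e^{2\pi s c(u,x)}\,g(f_u(x)),$$ which depends only on the first $N$ letters of $\omega$. Given a $\sigma$-invariant probability measure $\mathbb{Q}$ on $\Omega$, the triple $((\Phi^{(i)})_{i\in I},(\mathbf p_i)_{i\in I},\mathbb{Q})$ is called a model. It is non-trivial if $\mu_\omega$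 is non-atomic for $\mathbb{Q}$-a.e. $\omega$, and Bernoulli if $\mathbb{Q}$ is a Bernoulli measure. *)

(* Defs.v *)
From HB Require Import structures.
From mathcomp Require Import all_boot all_order all_algebra.
From mathcomp Require Import complex.
From mathcomp Require Import all_classical all_reals all_analysis.
From mathcomp Require Import measurable_realfun.

Set Implicit Arguments.
Unset Strict Implicit.
Unset Printing Implicit Defensive.

Import Order.TTheory GRing.Theory Num.Theory.
Import numFieldNormedType.Exports.
Local Open Scope classical_set_scope.
Local Open Scope ring_scope.

Notation unit_itv R := [set` `[0%R : R, 1%R]].

Section calculus.
Variable R : realType.
Implicit Types f g : R -> R.

Definition diff_quotient f (x y : R) : R := (f y - f x) / (y - x).

(* A map on [0,1] is a function R -> R whose values outside [0,1] are ignored.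
   Only points of [0,1] enter the difference quotients, so the derivative is
   one-sided at 0 and at 1. *)
Definition within_unit (x : R) : set_system R := within (unit_itv R) x^'.

Definition derivable01 f (x : R) : Prop :=
  cvg (diff_quotient f x y @[y --> within_unit x]).

Definition D01 f (x : R) : R := lim (diff_quotient f x y @[y --> within_unit x]).

Definition C1 f : Prop :=
  {in `[0, 1], forall x, derivable01 f x} /\
  {within unit_itv R, continuous (D01 f)}.

Definition C2 f : Prop := C1 f /\ C1 (D01 f).

Definition C1_complex (g : R -> R[i]) : Prop :=
  C1 (fun x => complex.Re (g x)) /\ C1 (fun x => complex.Im (g x)).

Definition log_abs_deriv f (x : R) : R := ln `|D01 f x|.

Definition cocycle f (x : R) : R := - log_abs_deriv f x.

Definition cexp (z : R[i]) : R[i] :=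
  ((expR (complex.Re z) * cos (complex.Im z)) +i*
   (expR (complex.Re z) * sin (complex.Im z)))%C.

(* e^(2 pi s t) *)
Definition twist (s : R[i]) (t : R) : R[i] := cexp ((2 * pi * t)%:C%C * s).

End calculus.

Section ifs.
Variables (R : realType) (n : nat).
Implicit Types (f : 'I_n -> R -> R) (p : 'I_n -> R).

Definition abs_derivs f : set R :=
  [set d | exists a : 'I_n, exists2 x, x \in `[0, 1] & d = `|D01 (f a) x|].

Definition contraction_rate f : R := sup (abs_derivs f).

Definition C2_ifs f : Prop :=
  [/\ forall a, f a @` unit_itv R `<=` unit_itv R,
      forall a, C2 (f a),
      0 < inf (abs_derivs f) &
      contraction_rate f < 1].

Definition common_fixed_point f : Prop :=
  exists2 x, x \in `[0, 1] & forall a, f a x = x.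

Definition is_attractor f (K : set R) : Prop :=
  [/\ K !=set0, compact K, K `<=` unit_itv R & K = \bigcup_a (f a @` K)].

Definition word_map f (w : seq 'I_n) : R -> R :=
  foldr (fun a g => f a \o g) idfun w.

Definition distortion_bound f (C : R) : Prop :=
  forall (w : seq 'I_n) (x : R), x \in `[0, 1] ->
    `|D01 (log_abs_deriv (word_map f w)) x| <= C.

Definition disjoint_images (g h : R -> R) : Prop :=
  (g @` unit_itv R) `&` (h @` unit_itv R) = set0.

(* With maps numbered from 0, the pairs (f_1, f_2) and (f_3, f_4) of the
   mathematical text are those with indices (0, 1) and (2, 3). *)
Definition distinguished_pair (i i' : 'I_n) : bool :=
  ((i == 0 :> nat) || (i == 2 :> nat)) && (i' == i.+1 :> nat).

(* Together with 0 < n this forces 4 <= n: taking k to be the first map, the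
   pair cannot be (0, 1), because f_k would meet itself. *)
Definition separation f : Prop :=
  forall k : 'I_n, exists i i' : 'I_n,
    [/\ distinguished_pair i i', disjoint_images (f i) (f i'),
        disjoint_images (f i) (f k) & disjoint_images (f i') (f k)].

Definition non_integrability f (C : R) : Prop :=
  exists m m' : R,
    [/\ 0 < m, 0 < m',
        forall i i', distinguished_pair i i' ->
          forall x, x \in `[0, 1] ->
            m <= `|D01 (log_abs_deriv (f i) \- log_abs_deriv (f i')) x| <= m' &
        0 < m - 2 * C * contraction_rate f].

Definition positive_prob_vector p : Prop :=
  (forall a, 0 < p a) /\ \sum_a p a = 1.

Definition self_conformal f p (nu : probability (measurableTypeR R) R) : Prop :=
  nu (unit_itv R) = 1%E /\
  forall A : set R, measurable A ->
    nu A = (\sum_a (p a)%:E * nu (unit_itv R `&` f a @^-1` A))%E.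

Definition transfer f p (s : R[i]) (g : R -> R[i]) : R -> R[i] :=
  fun x => \sum_a (p a)%:C%C * twist s (cocycle (f a) x) * g (f a x).

End ifs.

Section product_space.
Variable b : nat -> nat.

(* Every factor is nonempty, which the library requires of measurable spaces;
   hence the j-th factor has (b j).+1 elements. *)
Definition seq_space : Type := forall j : nat, 'I_(b j).+1.

HB.instance Definition _ := gen_eqMixin seq_space.
HB.instance Definition _ := gen_choiceMixin seq_space.
HB.instance Definition _ := isPointed.Build seq_space (fun=> ord0).

Definition cylinder (N : nat) (w : forall j : 'I_N, 'I_(b j).+1) :
    set seq_space :=
  [set v | forall j : 'I_N, v j = w j].

Definition cylinders : set (set seq_space) :=
  [set A | exists N (w : forall j : 'I_N, 'I_(b j).+1), A = cylinder w].

Definition product_space := g_sigma_algebraType cylinders.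

Definition product_measure (R : realType) (q : forall j, 'I_(b j).+1 -> R)
    (P : probability product_space R) : Prop :=
  forall N (w : forall j : 'I_N, 'I_(b j).+1),
    P (cylinder w) = (\prod_(j < N) q j (w j))%:E.

End product_space.

Definition omega_space (l : nat) := product_space (fun=> l).

Definition left_shift l (w : omega_space l) : omega_space l := fun j => w j.+1.

(* I = {0, ..., last_idx}, and the i-th system consists of k_i = (br i).+1
   maps.  Both are nonempty since they carry probability vectors. *)
Record model (R : realType) := Model {
  last_idx : nat ;
  br : 'I_last_idx.+1 -> nat ;
  maps : forall i, 'I_(br i).+1 -> R -> R ;
  weights : forall i, 'I_(br i).+1 -> R ;
  law : probability (omega_space last_idx) R ;
  maps_ifs : forall i, C2_ifs (maps (i := i)) ;
  weights_prob : forall i, positive_prob_vector (weights (i := i)) ;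
  law_shift : forall A, measurable A -> law (@left_shift _ @^-1` A) = law A
}.

Section models.
Variables (R : realType) (M : model R).

Definition index_set := 'I_(last_idx M).+1.
Definition Omega := omega_space (last_idx M).
Definition nmaps (i : index_set) : nat := (br i).+1.

Definition initial_word N (w : Omega) : 'I_N -> index_set := fun j => w j.

Definition words N (w : 'I_N -> index_set) := {dffun forall j : 'I_N, 'I_(br (w j)).+1}.

Definition fword N (w : 'I_N -> index_set) (u : words w) : R -> R :=
  \big[(fun g h => g \o h)/idfun]_(j < N) maps (u j).

Definition word_weight N (w : 'I_N -> index_set) (u : words w) : R :=
  \prod_(j < N) weights (u j).

Definition model_transfer N (w : 'I_N -> index_set) (s : R[i]) (g : R -> R[i]) :
    R -> R[i] :=
  fun x => \sum_(u : words w)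
    (word_weight u)%:C%C * twist s (cocycle (fword u) x) * g (fword u x).

Definition infinite_words (w : Omega) := product_space (fun j => br (w j)).

Definition truncate (w : Omega) (u : infinite_words w) N : words (@initial_word N w) :=
  [ffun j : 'I_N => u j].

Definition coding_map (w : Omega) (u : infinite_words w) : R :=
  limn (fun N => fword (truncate u N) 0).

(* eta^(w) is determined by its values on cylinders, hence so is mu_w. *)
Definition is_mu (w : Omega) (mu : probability (measurableTypeR R) R) : Prop :=
  exists2 eta : probability (infinite_words w) R,
    product_measure (fun j => weights (i := w j)) eta &
    forall A : set R, measurable A -> mu A = eta (@coding_map w @^-1` A).

Definition bernoulli_model : Prop :=
  exists2 q : index_set -> R,
    (forall i, 0 <= q i) /\ \sum_i q i = 1 &
    product_measure (fun=> q) (law M).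

Definition non_atomic (mu : probability (measurableTypeR R) R) : Prop :=
  forall x : R, mu [set x] = 0%E.

Definition msupport (mu : probability (measurableTypeR R) R) : set R :=
  [set x | forall r : R, 0 < r -> (0 < mu (ball x r))%E].

Definition nontrivial_model (mu : Omega -> probability (measurableTypeR R) R) :
    Prop :=
  {ae law M, forall w, non_atomic (mu w)}.

End models.

Arguments is_mu {R M} w mu.
Arguments initial_word {R M} N w _.

(* Main.v *)
Require Import Defs.
From HB Require Import structures.
From mathcomp Require Import all_boot all_order all_algebra.
From mathcomp Require Import complex.
From mathcomp Require Import all_classical all_reals all_analysis.
From mathcomp Require Import measurable_realfun.
From mathcomp Require Import ring lra.

Set Implicit Arguments.
Unset Strict Implicit.
Unset Printing Implicit Defensive.

Import Order.TTheory GRing.Theory Num.Theory.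
Import numFieldNormedType.Exports.
Local Open Scope classical_set_scope.
Local Open Scope ring_scope.

(** For each map [f_k] the separation property provides a pair [(f_i, f_i')] of
    distinguished maps such that the images of [f_k], [f_i], [f_i'] are pairwise
    disjoint. The model consists of all these triples: a small mass is taken from
    every [p_k] and spread over the two companions in such a way that the mixture
    of the triples is again [p], so both disintegrations reduce to distributing a
    product over a sum. For the measure, both [nu] and the mixture of the [mu_w] have
    upper tails squeezed between the same finite-level sums, up to a shift by
    [rho ^ N].

    Every fiber is the coding of a product measure by strongly separated maps
    with bounded distortion. Two codings that first differ at place [j] are at
    a distance comparable to the derivative of the common prefix, which gives
    injectivity, hence non-atomicity, and shows that the cylinders comparable to two
    concentric balls differ by a bounded number of letters, hence the Federer
    property. Two words that differ only in the last letter, which is applied first,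
    inherit non-integrability up to an error [2 * Ct * rho]. *)

(** * Derivatives on the unit interval *)

Section derivative_within.
Variable R : realType.
Implicit Types (A B : set R) (f g : R -> R) (x l : R).

(* Caratheodory's form of differentiability within [A]: composing derivatives is
   then a product of limits, with no division to guard. *)
Definition deriv_within A f x l : Prop :=
  exists2 phi : R -> R, (forall y, A y -> f y - f x = phi y * (y - x)) &
    phi y @[y --> within A (nbhs x)] --> l.

Lemma deriv_within_cvg A f x l : deriv_within A f x l ->
  f y @[y --> within A (nbhs x)] --> f x.
Proof.
move=> [phi fE phil].
have id_cvg : y - x @[y --> within A (nbhs x)] --> (0 : R).
  apply: cvg_within_filter.
  suff : y - x @[y --> x] --> x - x by rewrite subrr.
  by apply: cvgB; [exact: cvg_id | exact: cvg_cst].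
have : (phi y * (y - x)) + f x @[y --> within A (nbhs x)] --> l * 0 + f x.
  by apply: cvgD; [exact: cvgM | exact: cvg_cst].
rewrite mulr0 add0r => h; apply: cvg_trans h; apply: near_eq_cvg.
by rewrite near_withinE; near=> y => Ay; rewrite -fE// subrK.
Unshelve. all: by end_near. Qed.

Lemma deriv_within_comp A B f g x k l : (forall y, A y -> B (f y)) ->
  deriv_within A f x k -> deriv_within B g (f x) l ->
  deriv_within A (g \o f) x (l * k).
Proof.
move=> fAB df [psi gE psil]; have fc := deriv_within_cvg df.
have [phi fE phik] := df.
exists (fun y => psi (f y) * phi y).
  by move=> y Ay /=; rewrite gE ?fE ?mulrA//; exact: fAB.
apply: cvgM => //; apply: cvg_comp psil.
move=> V /= VB; have := fc _ VB; rewrite /nbhs /= /within /=.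
by apply: filterS => y + Ay; apply=> //; exact: fAB.
Qed.

Lemma deriv_withinD A f g x k l :
  deriv_within A f x k -> deriv_within A g x l ->
  deriv_within A (f \+ g) x (k + l).
Proof.
move=> [phi fE phik] [psi gE psil]; exists (phi \+ psi).
  by move=> y Ay /=; rewrite mulrDl -fE// -gE//; ring.
exact: cvgD.
Qed.

Lemma deriv_withinN A f x l : deriv_within A f x l ->
  deriv_within A (\- f) x (- l).
Proof.
move=> [phi fE phik]; exists (\- phi); last exact: cvgN.
by move=> y Ay /=; rewrite mulNr -fE//; ring.
Qed.

Lemma deriv_within_ext A f g x l : A x -> {in A, f =1 g} ->
  deriv_within A f x l -> deriv_within A g x l.
Proof.
move=> Ax fg [phi fE phil]; exists phi => // y Ay.
by rewrite -!fg ?inE// fE.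
Qed.

Lemma deriv_within_id A x : deriv_within A idfun x 1.
Proof. by exists (cst 1); [move=> y; rewrite mul1r | exact: cvg_cst]. Qed.

Lemma is_derive_deriv_within f x l : is_derive x 1 f l ->
  deriv_within setT f x l.
Proof.
move=> /is_derive1_caratheodory[phi [fE phic <-]]; exists phi => //.
exact: cvg_within_filter.
Qed.

Lemma deriv_within_is_derive A f x l : nbhs x A -> deriv_within A f x l ->
  is_derive x 1 f l.
Proof.
move=> nA [phi fE phil].
have Ax : A x by exact: nbhs_singleton.
(* [phi] factors [f] only on [A], while the characterization of [is_derive] asks for a factor valid
   everywhere. The difference quotient, completed by [l] at [x], provides one. *)
pose psi y := if y == x then l else (f y - f x) / (y - x).
apply/is_derive1_caratheodory; exists psi; split.
- move=> z; rewrite /psi; case: eqP => [->|/eqP zx]; first by rewrite !subrr mulr0.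
  by rewrite divfK// subr_eq0.
- have psix : psi x = l by rewrite /psi eqxx.
  suff : psi y @[y --> x] --> psi x by [].
  rewrite psix.
  have phil' : phi y @[y --> x] --> l.
    by apply: cvg_trans phil => V; apply: filterS2 nA => y Ay; apply.
  move=> V nV; have := phil' _ nV; apply: filterS2 nA => y Ay /= Vy.
  rewrite /psi; case: eqP => [_|/eqP yx]; first exact: nbhs_singleton.
  by rewrite fE// mulfK// subr_eq0.
- by rewrite /psi eqxx.
Unshelve. all: by end_near. Qed.

(** Maps of the system may reverse orientation, so derivatives of both signs occur; for negative [x]
    the function is locally [ln] after negation. *)
Lemma deriv_within_ln_abs x : x != 0 ->
  deriv_within setT (fun y => ln `|y|) x x^-1.
Proof.
move=> x0; have [x_gt0|x_le0] := ltP 0 x.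
  apply: is_derive_deriv_within.
  have h : is_derive x 1 (@ln R) x^-1 by exact: is_derive1_ln.
  apply: (near_eq_is_derive _ h).
  near=> y; rewrite gtr0_norm//.
  by near: y; exact: lt_nbhsr.
have x_lt0 : x < 0 by rewrite lt_neqAle x0.
apply: is_derive_deriv_within.
have h : is_derive (- x) 1 (@ln R) (- x)^-1 by apply: is_derive1_ln; rewrite oppr_gt0.
have h2 : is_derive x 1 (@ln R \o -%R) (x^-1).
  rewrite -[x^-1]opprK -invrN -[- (- x)^-1]mulrN1.
  apply: (@deriv_within_is_derive setT); first exact: filterT.
  apply: (@deriv_within_comp setT setT) => //; last exact: is_derive_deriv_within.
  exact: (deriv_withinN (@deriv_within_id _ _)).
apply: (near_eq_is_derive _ h2).
near=> y; rewrite /= ltr0_norm//.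
by near: y; exact: lt_nbhsl.
Unshelve. all: by end_near. Qed.

End derivative_within.

(** * One-sided derivatives and the mean value theorem on [0,1] *)

Section unit_interval.
Variable R : realType.
Local Notation U := (unit_itv R).
Implicit Types (f g df : R -> R) (x y l : R).

(** Makes the limit in [D01] unique, endpoints included. From any point one can move towards the
    farther endpoint by at most 1/2 without leaving the interval. *)
Lemma within_unit_proper x : x \in `[0, 1] -> ProperFilter (within_unit x).
Proof.
rewrite in_itv /= => /andP[x0 x1]; rewrite /within_unit.
split; last exact: within_filter.
rewrite /within /= => /nbhs_ballP [e /= e0 xe].
have m0 : 0 < Num.min (e / 2) (1 / 2) by rewrite lt_min !divr_gt0.
have me : Num.min (e / 2) (1 / 2) < e.
  by rewrite gt_min; apply/orP; left; lra.
have m2 : Num.min (e / 2) (1 / 2) <= 1 / 2 by rewrite ge_min lexx orbT.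
have [x2|x2] := leP x (1 / 2).
- apply: (xe (x + Num.min (e / 2) (1 / 2))).
  + by rewrite /ball /= opprD addrA subrr sub0r normrN gtr0_norm.
  + by rewrite -subr_eq0 addrC addKr gt_eqF.
  + by rewrite /= in_itv /=; apply/andP; split; lra.
- apply: (xe (x - Num.min (e / 2) (1 / 2))).
  + by rewrite /ball /= opprB addrC subrK gtr0_norm.
  + by rewrite -subr_eq0 addrC addKr oppr_eq0 gt_eqF.
  + by rewrite /= in_itv /=; apply/andP; split; lra.
Qed.

Lemma D01E f x l : x \in `[0, 1] -> deriv_within U f x l -> D01 f x = l.
Proof.
move=> xU [phi fE phil]; rewrite /D01.
have FF := within_unit_proper xU.
have h : phi y @[y --> within_unit x] --> l.
  move=> V /phil; rewrite /within_unit /nbhs /= /within /=; apply: filterS.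
  by move=> y h _.
apply: (@cvg_lim _ (@Rhausdorff R) _ _ FF).
apply: cvg_trans h; apply: near_eq_cvg; rewrite /within_unit !near_withinE.
near=> y => yx yU.
by rewrite /diff_quotient fE// mulfK// subr_eq0.
Unshelve. all: by end_near. Qed.

Lemma derivable01_deriv_within f x : derivable01 f x ->
  deriv_within U f x (D01 f x).
Proof.
move=> h; have {}h : diff_quotient f x y @[y --> within_unit x] --> D01 f x by [].
(* The filter in [deriv_within] is not punctured, so the quotient receives its limit as value at
   [x]. *)
exists (fun y => if y == x then D01 f x else diff_quotient f x y) => [y yU|].
  case: eqP => [->|/eqP yx]; first by rewrite !subrr mulr0.
  by rewrite /diff_quotient divfK// subr_eq0.
move=> V nV; have [e e0 he] := h _ nV; exists e => // y ye yU /=.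
by case: eqP => [_|/eqP yx]; [exact: nbhs_singleton | exact: he].
Qed.

(** Points strictly between [x] and [y] are interior to [0,1], where the derivative is two-sided and
    the usual theorem applies. Only [z] in [0,1] is recorded, because all later bounds are uniform
    there. *)
Lemma deriv_within_mvt f df :
  (forall x, x \in `[0, 1] -> deriv_within U f x (df x)) ->
  forall x y, x \in `[0, 1] -> y \in `[0, 1] ->
    exists2 z, z \in `[0, 1] & f y - f x = df z * (y - x).
Proof.
move=> fdf.
have lt_case x y : x \in `[0, 1] -> y \in `[0, 1] -> x < y ->
    exists2 z, z \in `[0, 1] & f y - f x = df z * (y - x).
  rewrite !in_itv/= => /andP[x0 x1] /andP[y0 y1] xy.
  have sub z : z \in `]x, y[ -> z \in `]0, 1[.
    rewrite !in_itv /= => /andP[xz zy].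
    by rewrite (le_lt_trans x0 xz) (lt_le_trans zy y1).
  have [z zxy ->] : exists2 z, z \in `]x, y[ & f y - f x = df z * (y - x).
    apply: MVT => //.
    - move=> z /sub z01; apply: (@deriv_within_is_derive _ U).
        apply: filterS (near_in_itvoo z01) => w /=.
        by rewrite !in_itv /= => /andP[/ltW -> /ltW ->].
      by apply: fdf; apply: subset_itv_oo_cc z01.
    - apply/subspace_continuousP => z /=; rewrite in_itv /= => /andP[xz zy].
      have zU : z \in `[0, 1] by rewrite in_itv /=; apply/andP; split; lra.
      have := deriv_within_cvg (fdf _ zU); apply: cvg_trans.
      move=> V; rewrite /nbhs /= /within /=; apply: filterS => w h.
      by rewrite in_itv /= => /andP[xw wy]; apply: h; rewrite /= in_itv /=; apply/andP; split; lra.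
  by exists z => //; apply: subset_itv_oo_cc (sub _ zxy).
move=> x y xU yU; have [xy|yx|->] := ltgtP x y.
- exact: lt_case.
- have [z zU h] := lt_case _ _ yU xU yx; exists z => //.
  by rewrite -opprB h -mulrN opprB.
- by exists y => //; rewrite !subrr mulr0.
Qed.

End unit_interval.

(** * Words: distortion and coding *)

Section words_of_ifs.
Variables (R : realType) (n : nat) (f : 'I_n -> R -> R).
Hypothesis f_ifs : C2_ifs f.
Local Notation U := (unit_itv R).
Local Notation rho := (contraction_rate f).
Local Notation W := (word_map f).

Lemma ifs_unit a x : x \in `[0, 1] -> f a x \in `[0, 1].
Proof. by case: f_ifs => fU _ _ _ xU; apply: fU; exists x. Qed.

Lemma ifs_deriv a x : x \in `[0, 1] -> deriv_within U (f a) x (D01 (f a) x).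
Proof.
case: f_ifs => _ /(_ a)[[h _] _] _ _ xU.
by apply: derivable01_deriv_within; exact: h.
Qed.

Lemma ifs_deriv2 a x : x \in `[0, 1] ->
  deriv_within U (D01 (f a)) x (D01 (D01 (f a)) x).
Proof.
case: f_ifs => _ /(_ a)[_ [h _]] _ _ xU.
by apply: derivable01_deriv_within; exact: h.
Qed.

(** The supremum defining [contraction_rate] is informative only for a bounded set; the bound comes
    from continuity of the derivative on a compact interval. *)
Lemma abs_deriv_bounded a :
  exists M, forall x, x \in `[0, 1] -> `|D01 (f a) x| <= M.
Proof.
have [_ f2 _ _] := f_ifs.
have c : {within `[0, 1], continuous (fun x => `|D01 (f a) x|)}.
  apply/subspace_continuousP => x xU; apply: cvg_norm.
  by have [[_ /subspace_continuousP h] _] := f2 a; exact: h.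
have [z zU h] := EVT_max (@ler01 R) c.
by exists `|D01 (f a) z|.
Qed.

Lemma has_sup_abs_derivs (a : 'I_n) : has_sup (abs_derivs f).
Proof.
split; first by exists `|D01 (f a) 0|, a, 0 => //; rewrite in_itv /= lexx ler01.
have /choice[M hM] := abs_deriv_bounded.
exists (\sum_b Num.max 0 (M b)) => _ [b [x xU ->]].
rewrite (bigD1 b)//=; apply: ler_wpDr.
  by apply: sumr_ge0 => i _; rewrite le_max lexx.
by rewrite le_max hM ?orbT.
Qed.

Lemma has_inf_abs_derivs (a : 'I_n) : has_inf (abs_derivs f).
Proof.
split; first by exists `|D01 (f a) 0|, a, 0 => //; rewrite in_itv /= lexx ler01.
by exists 0 => _ [b [x xU ->]].
Qed.

Lemma abs_deriv_le a x : x \in `[0, 1] -> `|D01 (f a) x| <= rho.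
Proof.
move=> xU; apply: sup_upper_bound; last by exists a, x.
exact: has_sup_abs_derivs a.
Qed.

Lemma abs_deriv_ge a x : x \in `[0, 1] -> inf (abs_derivs f) <= `|D01 (f a) x|.
Proof.
move=> xU; apply: ge_inf; last by exists a, x.
by exists 0 => _ [b [y yU ->]].
Qed.

Lemma ifs_deriv_neq0 a x : x \in `[0, 1] -> D01 (f a) x != 0.
Proof.
move=> xU; rewrite -normr_gt0; apply: lt_le_trans (abs_deriv_ge a xU).
by case: f_ifs.
Qed.

Lemma rate_ge0 (a : 'I_n) : 0 <= rho.
Proof.
apply: le_trans (abs_deriv_le a (x := 0) _); first exact: normr_ge0.
by rewrite in_itv /= lexx ler01.
Qed.

Lemma rate_lt1 : rho < 1. Proof. by case: f_ifs. Qed.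

(** Passing to fewer maps raises the infimum and lowers the supremum of the derivatives, as long as
    the family is nonempty, which the index type ['I_k.+1] ensures. *)
Lemma subfamily_C2_ifs k (e : 'I_k.+1 -> 'I_n) : C2_ifs (fun j => f (e j)).
Proof.
have [fU f2 inf0 rho1] := f_ifs.
have sub : abs_derivs (fun j => f (e j)) `<=` abs_derivs f.
  by move=> _ [j [x xU ->]]; exists (e j), x.
have ne : abs_derivs (fun j => f (e j)) !=set0.
  by exists `|D01 (f (e ord0)) 0|, ord0, 0 => //; rewrite in_itv /= lexx ler01.
split => //.
- apply: (lt_le_trans inf0); apply: lb_le_inf => // y /sub yf.
  by apply: ge_inf yf; exact: (has_inf_abs_derivs (e ord0)).2.
- apply: le_lt_trans rho1; apply: sup_le_ub => // y /sub yf.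
  by apply: sup_upper_bound yf; exact: (has_sup_abs_derivs (e ord0)).
Qed.

Lemma word_map_cat s t : W (s ++ t) =1 W s \o W t.
Proof. by elim: s => //= a s IH x /=; rewrite IH. Qed.

Lemma word_unit s x : x \in `[0, 1] -> W s x \in `[0, 1].
Proof. by move=> xU; elim: s => //= a s IH; exact: ifs_unit. Qed.

Lemma word_deriv s x : x \in `[0, 1] -> deriv_within U (W s) x (D01 (W s) x).
Proof.
move=> xU; suff [l h] : exists l, deriv_within U (W s) x l by rewrite (D01E xU h).
elim: s => [|a s [l h]]; first by exists 1; exact: deriv_within_id.
exists (D01 (f a) (W s x) * l); apply: (deriv_within_comp (B := U)) => //.
  by move=> y; exact: word_unit.
by apply: ifs_deriv; exact: word_unit.
Qed.

Lemma D01_word_nil x : x \in `[0, 1] -> D01 (W [::]) x = 1.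
Proof. by move=> xU; apply: D01E => //; exact: deriv_within_id. Qed.

Lemma D01_word_cat s t x : x \in `[0, 1] ->
  D01 (W (s ++ t)) x = D01 (W s) (W t x) * D01 (W t) x.
Proof.
move=> xU; apply: D01E => //.
apply: (@deriv_within_ext _ _ (W s \o W t)) => //.
  by move=> y _; rewrite word_map_cat.
apply: (deriv_within_comp (B := U)); last 2 first.
- exact: word_deriv.
- by apply: word_deriv; exact: word_unit.
- by move=> y; exact: word_unit.
Qed.

Lemma D01_word_cons a s x : x \in `[0, 1] ->
  D01 (W (a :: s)) x = D01 (f a) (W s x) * D01 (W s) x.
Proof. by rewrite -cat1s; exact: D01_word_cat. Qed.

Lemma D01_word_neq0 s x : x \in `[0, 1] -> D01 (W s) x != 0.
Proof.
move=> xU; elim: s => [|a s IH]; first by rewrite D01_word_nil ?oner_eq0.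
by rewrite D01_word_cons// mulf_neq0// ifs_deriv_neq0// word_unit.
Qed.

Lemma D01_word_le s x : x \in `[0, 1] -> `|D01 (W s) x| <= rho ^+ size s.
Proof.
move=> xU; elim: s => [|a s IH]; first by rewrite D01_word_nil// normr1.
by rewrite D01_word_cons// normrM exprS ler_pM// abs_deriv_le// word_unit.
Qed.

Lemma word_lipschitz s x y : x \in `[0, 1] -> y \in `[0, 1] ->
  `|W s x - W s y| <= rho ^+ size s.
Proof.
move=> xU yU.
have [z zU ->] := deriv_within_mvt (word_deriv s) yU xU.
rewrite normrM -[leRHS]mulr1 ler_pM// ?D01_word_le//.
move: xU yU; rewrite !in_itv /= => /andP[x0 x1] /andP[y0 y1].
by rewrite ler_norml; apply/andP; split; lra.
Qed.

Local Notation L s := (log_abs_deriv (W s)).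

Lemma log_abs_deriv_cat s t x : x \in `[0, 1] ->
  L (s ++ t) x = L s (W t x) + L t x.
Proof.
move=> xU; rewrite /log_abs_deriv D01_word_cat// normrM lnM// posrE normr_gt0.
  by rewrite D01_word_neq0// word_unit.
exact: D01_word_neq0.
Qed.

Lemma deriv_within_comp_word g t x l : x \in `[0, 1] ->
  deriv_within U g (W t x) l ->
  deriv_within U (g \o W t) x (l * D01 (W t) x).
Proof.
move=> xU; apply: deriv_within_comp; first by move=> y; exact: word_unit.
exact: word_deriv.
Qed.

(** Induction on the word: the logarithm turns the chain rule into a sum, so only second derivatives
    of single maps are needed. *)
Lemma log_abs_deriv_deriv s x : x \in `[0, 1] ->
  deriv_within U (L s) x (D01 (L s) x).
Proof.
move=> xU; suff [l h] : exists l, deriv_within U (L s) x l by rewrite (D01E xU h).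
elim: s x xU => [|a s IH] x xU.
  exists 0; apply: (@deriv_within_ext _ _ (cst 0)) => //.
    by move=> y /set_mem yU; rewrite /log_abs_deriv D01_word_nil//= normr1 ln1.
  by exists (cst 0); [move=> y _; rewrite subrr mul0r | exact: cvg_cst].
have [l h] := IH x xU.
have h1 : deriv_within U (fun y => ln `|D01 (f a) y|) (W s x)
    ((D01 (f a) (W s x))^-1 * D01 (D01 (f a)) (W s x)).
  apply: (@deriv_within_comp _ _ setT (D01 (f a)) (fun y => ln `|y|)) => //.
    by apply: ifs_deriv2; exact: word_unit.
  by apply: deriv_within_ln_abs; apply: ifs_deriv_neq0; exact: word_unit.
eexists; apply: (@deriv_within_ext _ _ (((fun y => ln `|D01 (f a) y|) \o W s) \+ L s) (L (a :: s))); first exact: xU.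
  by move=> y /set_mem yU; rewrite -cat1s log_abs_deriv_cat.
exact: (deriv_withinD (deriv_within_comp_word xU h1) h).
Qed.

(** The contribution of the prefix [s] is damped by the derivative of [t]; this is why the innermost
    letter decides non-integrability. *)
Lemma D01_log_abs_deriv_cat s t x : x \in `[0, 1] ->
  D01 (L (s ++ t)) x = D01 (L s) (W t x) * D01 (W t) x + D01 (L t) x.
Proof.
move=> xU; apply: D01E => //.
apply: (@deriv_within_ext _ _ ((L s \o W t) \+ L t)) => //.
  by move=> y /set_mem yU; rewrite log_abs_deriv_cat.
apply: deriv_withinD; last exact: log_abs_deriv_deriv.
apply: deriv_within_comp_word => //.
by apply: log_abs_deriv_deriv; exact: word_unit.
Qed.

Lemma D01_log_abs_derivB s t x : x \in `[0, 1] ->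
  D01 (L s \- L t) x = D01 (L s) x - D01 (L t) x.
Proof.
move=> xU; apply: D01E => //; apply: deriv_withinD.
  exact: log_abs_deriv_deriv.
by apply: deriv_withinN; exact: log_abs_deriv_deriv.
Qed.

Variable Ct : R.
Hypothesis f_dist : distortion_bound f Ct.

Lemma distortion_ge0 : 0 <= Ct.
Proof.
apply: le_trans (f_dist [::] (x := 0) _); first exact: normr_ge0.
by rewrite in_itv /= lexx ler01.
Qed.

(** By the mean value theorem [log |W'|] varies by at most [Ct] over an interval of length 1;
    exponentiate. *)
Lemma deriv_distortion s x y : x \in `[0, 1] -> y \in `[0, 1] ->
  `|D01 (W s) x| <= expR Ct * `|D01 (W s) y|.
Proof.
move=> xU yU.
have [z zU h] := deriv_within_mvt (log_abs_deriv_deriv s) yU xU.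
have hle : L s x - L s y <= Ct.
  rewrite (le_trans (ler_norm _))// h normrM -[leRHS]mulr1 ler_pM// ?f_dist//.
  move: xU yU; rewrite !in_itv /= => /andP[x0 x1] /andP[y0 y1].
  by rewrite ler_norml; apply/andP; split; lra.
have E w : w \in `[0, 1] -> `|D01 (W s) w| = expR (L s w).
  by move=> wU; rewrite lnK// posrE normr_gt0 D01_word_neq0.
by rewrite !E// -expRD ler_expR -lerBlDr.
Qed.

(* The contraction of a word is measured by its derivative at 0, the choice of
   the point being immaterial up to the factor [expR Ct]. *)
Local Notation size_of s := `|D01 (W s) 0|.

Let U0 : (0 : R) \in `[0, 1]. Proof. by rewrite in_itv /= lexx ler01. Qed.

Lemma word_dist_le s x y : x \in `[0, 1] -> y \in `[0, 1] ->
  `|W s x - W s y| <= expR Ct * size_of s * `|x - y|.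
Proof.
move=> xU yU; have [z zU ->] := deriv_within_mvt (word_deriv s) yU xU.
by rewrite normrM ler_wpM2r// deriv_distortion.
Qed.

Lemma word_dist_ge s x y : x \in `[0, 1] -> y \in `[0, 1] ->
  expR (- Ct) * size_of s * `|x - y| <= `|W s x - W s y|.
Proof.
move=> xU yU; have [z zU ->] := deriv_within_mvt (word_deriv s) yU xU.
rewrite normrM ler_wpM2r// expRN mulrC ler_pdivrMr ?expR_gt0// mulrC.
exact: deriv_distortion.
Qed.

Lemma size_of_cat s t : size_of (s ++ t) <= expR Ct * size_of s * rho ^+ size t.
Proof.
rewrite D01_word_cat// normrM ler_pM// ?deriv_distortion ?word_unit//.
exact: D01_word_le.
Qed.

End words_of_ifs.

(** A minimum along the enumeration. It yields the mass moved between letters, the gap between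
    images and the least weight. *)
Lemma finite_uniform_gt0 (R : realType) (T : finType) (P : T -> R -> Prop) :
  (forall t (d e : R), e <= d -> P t d -> P t e) ->
  (forall t, exists2 d : R, 0 < d & P t d) ->
  exists2 d : R, 0 < d & forall t, P t d.
Proof.
move=> Pmono Pex.
suff h (s : seq T) : exists2 d : R, 0 < d & forall t, t \in s -> P t d.
  by have [d d0 dP] := h (enum T); exists d => // t; apply: dP; rewrite mem_enum.
elim: s => [|t s [d d0 dP]]; first by exists 1.
have [e e0 eP] := Pex t; exists (Num.min d e); first by rewrite lt_min d0.
move=> u; rewrite inE => /predU1P[->|us]; first by apply: Pmono eP; rewrite ge_min lexx orbT.
by apply: Pmono (dP _ us); rewrite ge_min lexx.
Qed.

(** * Limit points of infinite words and the distances between them *)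

Section coding.
Variables (R : realType) (n : nat) (f : 'I_n -> R -> R) (Ct : R).
Hypothesis f_ifs : C2_ifs f.
Hypothesis f_dist : distortion_bound f Ct.
Local Notation U := (unit_itv R).
Local Notation rho := (contraction_rate f).
Local Notation W := (word_map f).
Local Notation size_of s := `|D01 (W s) 0|.
Implicit Types a b : nat -> 'I_n.

Let U0 : (0 : R) \in `[0, 1]. Proof. by rewrite in_itv /= lexx ler01. Qed.

(** Compactness: the set of differences of the two images is compact and avoids 0, hence avoids a
    ball around 0. *)
Lemma disjoint_images_gap i j : disjoint_images (f i) (f j) ->
  exists2 d : R, 0 < d &
    forall x y, x \in `[0, 1] -> y \in `[0, 1] -> d <= `|f i x - f j y|.
Proof.
move=> ij.
have cU k : compact (f k @` U).
  apply: continuous_compact; last exact: segment_compact.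
  apply/subspace_continuousP => x xU.
  exact: (deriv_within_cvg (ifs_deriv f_ifs k xU)).
pose D := (fun z : R * R => z.1 - z.2) @` ((f i @` U) `*` (f j @` U)).
have cD : compact D.
  apply: continuous_compact; last exact: compact_setX.
  apply: continuous_subspaceT => z.
  by apply: cvgB; [exact: cvg_fst | exact: cvg_snd].
have D0 : ~ D 0.
  move=> [[_ _] /= [[x xU <-] [y yU <-]] /eqP]; rewrite subr_eq0 => /eqP xy.
  suff : set0 (f i x) by []; rewrite -ij; split; first by exists x.
  by exists y.
have /nbhs_ballP[d /= d0 dD] : nbhs (0 : R) (~` D).
  apply: open_nbhs_nbhs; split => //; apply: closed_openC.
  by apply: (compact_closed _ cD); exact: Rhausdorff.
exists d => // x y xU yU; rewrite leNgt; apply/negP => xyd.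
apply: (dD (f i x - f j y)); first by rewrite /ball /= sub0r normrN.
by exists (f i x, f j y) => //; split; [exists x | exists y].
Qed.

Definition coded a : R := limn (fun N => W (mkseq a N) 0).

Lemma mkseqD a k N : mkseq a (k + N) = mkseq a k ++ [seq a i | i <- iota k N].
Proof. by rewrite /mkseq iotaD map_cat. Qed.

Lemma prefix_dist_le a k N : (k <= N)%N ->
  `|W (mkseq a N) 0 - W (mkseq a k) 0| <= rho ^+ k.
Proof.
move=> kN; rewrite -(subnKC kN) mkseqD word_map_cat /=.
apply: le_trans (word_lipschitz f_ifs _ _ _) _ => //; first exact: word_unit.
by rewrite size_mkseq.
Qed.

Lemma rate_expr_cvg0 (i : 'I_n) : rho ^+ N @[N --> \oo] --> (0 : R).
Proof.
apply: cvg_expr; rewrite ger0_norm ?(rate_lt1 f_ifs)//. exact: (rate_ge0 f_ifs i).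
Qed.

Lemma coded_cvg a : W (mkseq a N) 0 @[N --> \oo] --> coded a.
Proof.
apply/cauchy_cvgP/cauchy_exP => e e0.
have /cvgr0Pnorm_lt/(_ e e0)[N _ hN] := rate_expr_cvg0 (a 0%N).
exists (W (mkseq a N) 0); exists N => // k /= Nk.
rewrite /ball /= distrC (le_lt_trans (prefix_dist_le a Nk))//.
by have := hN N (leqnn N); rewrite ger0_norm ?exprn_ge0 ?(rate_ge0 f_ifs (a 0%N)).
Qed.

Lemma coded_prefix_dist a k : `|coded a - W (mkseq a k) 0| <= rho ^+ k.
Proof.
have h : `|W (mkseq a N) 0 - W (mkseq a k) 0| @[N --> \oo] --> `|coded a - W (mkseq a k) 0|.
  by apply: cvg_norm; apply: cvgB; [exact: coded_cvg | exact: cvg_cst].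
apply: (cvgr_to_le h); exists k => // N /= kN; exact: prefix_dist_le.
Qed.

Lemma eq_mkseq_prefix a b k : (forall j, (j < k)%N -> a j = b j) ->
  mkseq a k = mkseq b k.
Proof. by move=> ab; apply/eq_in_map => j; rewrite mem_iota => /ab. Qed.

Let coded_dist_cvg a b :
  `|W (mkseq a N) 0 - W (mkseq b N) 0| @[N --> \oo] --> `|coded a - coded b|.
Proof. by apply: cvg_norm; apply: cvgB; exact: coded_cvg. Qed.

Lemma coded_common_prefix a b k : (forall j, (j < k)%N -> a j = b j) ->
  `|coded a - coded b| <= expR Ct * size_of (mkseq a k).
Proof.
move=> ab; have h := @coded_dist_cvg a b; apply: (cvgr_to_le h); exists k => // N /= kN.
rewrite -(subnKC kN) !mkseqD -(eq_mkseq_prefix ab) !word_map_cat /=.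
apply: le_trans (word_dist_le f_ifs f_dist _ _ _) _; try exact: word_unit.
rewrite ler_piMr ?mulr_ge0 ?expR_ge0//.
(* The bound for the empty word, with constant [rho ^+ 0], says that two points of [0,1] are at
   distance at most 1. *)
by apply: le_trans (word_lipschitz f_ifs [::] _ _) _ => //; exact: word_unit.
Qed.

(** Whatever the later letters are, the letters at place [k] put the points at least [d] apart, and
    the common prefix shrinks this by a factor at least [expR (- Ct)] times its derivative at 0. *)
Lemma coded_separated a b k (d : R) : 0 <= d ->
  (forall j, (j < k)%N -> a j = b j) ->
  (forall x y, x \in `[0, 1] -> y \in `[0, 1] -> d <= `|f (a k) x - f (b k) y|) ->
  expR (- Ct) * size_of (mkseq a k) * d <= `|coded a - coded b|.
Proof.
move=> d0 ab dab; have h := @coded_dist_cvg a b; apply: (cvgr_to_ge h); exists k.+1 => // N /= kN.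
rewrite -(subnKC (ltnW kN)) !mkseqD -(eq_mkseq_prefix ab) !word_map_cat.
have -> : (N - k = (N - k.+1).+1)%N by rewrite subnSK.
rewrite /=; apply: le_trans (word_dist_ge f_ifs f_dist _ _ _).
- by rewrite ler_wpM2l ?mulr_ge0 ?expR_ge0// dab// word_unit.
- by apply: (ifs_unit f_ifs); exact: word_unit.
- by apply: (ifs_unit f_ifs); exact: word_unit.
Qed.

End coding.

(** * Product measures *)

Section digit.
Variables (R : realType) (k : nat) (q : 'I_k.+1 -> R).
Hypothesis q_gt0 : forall i, 0 < q i.
Hypothesis q_sum : \sum_i q i = 1.

(** The cumulative distribution of [q]: its successive values cut [0,1[ into pieces of lengths
    [q i]. *)
Definition weight_below (m : nat) : R := \sum_(i < k.+1 | (i < m)%N) q i.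

Lemma weight_belowS (i : 'I_k.+1) :
  weight_below i.+1 = weight_below i + q i.
Proof.
rewrite /weight_below (bigD1 i)//= addrC; congr (_ + _).
by apply: eq_bigl => j; rewrite ltnS [in RHS]ltn_neqAle andbC.
Qed.

Lemma weight_below_le m m' : (m <= m')%N -> weight_below m <= weight_below m'.
Proof.
move=> mm'; rewrite /weight_below [leRHS](bigID (fun i : 'I__ => (i < m)%N))/=.
rewrite [X in _ <= X + _](eq_bigl (fun i : 'I_k.+1 => (i < m)%N)); last first.
  by move=> i; rewrite andbC; case: ltnP => //= im; rewrite (leq_trans im).
by rewrite lerDl sumr_ge0// => i _; exact: ltW.
Qed.

Lemma weight_below0 : weight_below 0 = 0.
Proof. by rewrite /weight_below big_pred0. Qed.

Lemma weight_below_max : weight_below k.+1 = 1.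
Proof. by rewrite -q_sum; apply: eq_bigl => i; rewrite ltn_ord. Qed.

Definition digit (y : R) : 'I_k.+1 :=
  odflt ord0 [pick i : 'I_k.+1 | weight_below i <= y < weight_below i.+1].

Lemma digitP y i : 0 <= y < 1 ->
  digit y = i <-> weight_below i <= y < weight_below i + q i.
Proof.
rewrite -weight_belowS => /andP[y0 y1]; split; rewrite /digit; case: pickP => //=.
- by move=> j jy <-.
- move=> none; exfalso.
  (* The least [m] whose cumulative weight exceeds [y] is positive, and its predecessor is the
     digit. *)
  have ex : exists m, y < weight_below m by exists k.+1; rewrite weight_below_max.
  case: (ex_minnP ex) => -[|m] ym mmin; first by rewrite weight_below0 ltNge y0 in ym.
  have mk : (m < k.+1)%N by apply: mmin; rewrite weight_below_max.
  have := none (Ordinal mk); rewrite /= ym andbT leNgt => /negbFE/mmin.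
  by rewrite ltnn.
- move=> j /andP[jy yj] /andP[iy yi]; apply/val_inj; apply/eqP; rewrite eqn_leq.
  apply/andP; split; rewrite leqNgt; apply/negP => /weight_below_le.
  + by rewrite leNgt (le_lt_trans jy yi).
  + by rewrite leNgt (le_lt_trans iy yj).
- by move=> none; rewrite none.
Qed.

End digit.

(** * Product measures as images of Lebesgue measure on [0,1[ *)

Section product_measure_exists.
Variables (R : realType) (b : nat -> nat) (q : forall j, 'I_(b j).+1 -> R).
Local Arguments q : clear implicits.
Hypothesis q_gt0 : forall j i, 0 < q j i.
Hypothesis q_sum : forall j, \sum_i q j i = 1.
Local Arguments q_gt0 : clear implicits.

(* The sequence of digits of [y]: the unit interval is cut in proportion to
   [q 0], the piece containing [y] is rescaled to [0, 1[, and so on, so that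
   cylinders correspond to intervals of the right length. *)
Fixpoint rescaled (y : R) (j : nat) : R :=
  if j is i.+1 then
    let d := digit (q i) (rescaled y i) in
    (rescaled y i - weight_below (q i) d) / q i d
  else y.

(** The constant value off [0,1[ concerns a null set of the measure used below and keeps the map
    measurable. *)
Definition digits (y : R) : product_space b :=
  fun j => if 0 <= y < 1 then digit (q j) (rescaled y j) else ord0.

Section cylinder_interval.
Variable w : forall j, 'I_(b j).+1.

Definition cyl_length N : R := \prod_(j < N) q j (w j).

Fixpoint cyl_start N : R :=
  if N is j.+1 then cyl_start j + cyl_length j * weight_below (q j) (w j)
  else 0.

Lemma cyl_length_gt0 N : 0 < cyl_length N.
Proof. by apply: prodr_gt0 => j _. Qed.

Lemma cyl_lengthS N : cyl_length N.+1 = cyl_length N * q N (w N).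
Proof. by rewrite /cyl_length big_ord_recr. Qed.

Lemma cyl_interval_sub N : 0 <= cyl_start N /\ cyl_start N + cyl_length N <= 1.
Proof.
elim: N => [|N [s0 s1]]; first by rewrite /cyl_length big_ord0 /= add0r !lexx.
have := weight_below_le (q_gt0 N) (leq0n (w N)); rewrite weight_below0 => low0.
have := weight_below_le (q_gt0 N) (ltn_ord (w N)).
rewrite weight_belowS weight_below_max// => low1.
rewrite cyl_lengthS /=; have l0 := cyl_length_gt0 N; split; first by nra.
apply: le_trans s1; rewrite -addrA -mulrDr lerD2l.
by rewrite -[leRHS]mulr1 ler_wpM2l// ltW.
Qed.

(** The two claims are proved together: the formula for [rescaled y N] locates the next digit, and
    the interval condition shows that the rescaled point lies in [0,1[, where [digitP] applies. *)
Lemma cylinder_interval y N : 0 <= y < 1 ->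
  ((forall j, (j < N)%N -> digits y j = w j) <->
    cyl_start N <= y < cyl_start N + cyl_length N) /\
  ((forall j, (j < N)%N -> digits y j = w j) ->
    rescaled y N = (y - cyl_start N) / cyl_length N).
Proof.
move=> y01; elim: N => [|N [IH1 IH2]].
  by rewrite /cyl_length big_ord0 /= add0r subr0 divr1.
have l0 := cyl_length_gt0 N.
have split_last : (forall j, (j < N.+1)%N -> digits y j = w j) <->
    (forall j, (j < N)%N -> digits y j = w j) /\ digits y N = w N.
  split=> [h|[h hN] j].
    by split=> [j jN|]; apply: h => //; exact: ltnW.
  by rewrite ltnS leq_eqVlt => /predU1P[->|/h].
have digitN : (forall j, (j < N)%N -> digits y j = w j) ->
    digits y N = w N <->
    cyl_start N.+1 <= y < cyl_start N.+1 + cyl_length N.+1.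
  move=> h; rewrite /digits y01 IH2//; have /andP[h1 h2] := IH1.1 h.
  rewrite digitP//; last first.
    by rewrite ltr_pdivrMr// mul1r ltrBlDl h2 divr_ge0 ?subr_ge0// ltW.
  rewrite ler_pdivlMr// ltr_pdivrMr// cyl_lengthS /= lerBrDl ltrBlDl.
  by rewrite mulrDl addrA !(mulrC _ (cyl_length N)).
split.
  rewrite split_last; split=> [[h hN]|h]; first exact/digitN.
  have low0 := weight_below_le (q_gt0 N) (leq0n (w N)).
  rewrite weight_below0 in low0.
  have := weight_below_le (q_gt0 N) (ltn_ord (w N)).
  rewrite weight_belowS weight_below_max// => low1.
  have hN : forall j, (j < N)%N -> digits y j = w j.
    apply/IH1; move: h; rewrite cyl_lengthS /= => /andP[h1 h2]; apply/andP; split.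
      by apply: le_trans h1; rewrite lerDl mulr_ge0// ltW.
    apply: (lt_le_trans h2); rewrite -addrA -mulrDr lerD2l.
    by rewrite -[leRHS]mulr1 ler_wpM2l// ltW.
  by split => //; exact/digitN.
move=> /split_last[h hN]; rewrite /=.
have := hN; rewrite /digits y01 => ->.
rewrite IH2// cyl_lengthS; have q0 := q_gt0 (w N).
by field; rewrite !gt_eqF.
Qed.

End cylinder_interval.

(** Cylinders carry finite words, whereas [cyl_start] and [cyl_length] take infinite ones. They read
    only the first [N] letters, so the padding is immaterial. *)
Definition extend_word N (w : forall j : 'I_N, 'I_(b j).+1) (j : nat) : 'I_(b j).+1 :=
  if (j < N)%N =P true is ReflectT h then w (Ordinal h) else ord0.

Lemma extend_wordE N (w : forall j : 'I_N, 'I_(b j).+1) (j : 'I_N) :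
  extend_word w j = w j.
Proof.
case: j => j jN /=; rewrite /extend_word; case: eqP => // h.
by rewrite (bool_irrelevance h jN).
Qed.

Lemma extend_word_forall N (w : forall j : 'I_N, 'I_(b j).+1) (v : seq_space b) :
  (forall j, (j < N)%N -> v j = extend_word w j) <-> cylinder w v.
Proof.
split=> [h j|h j jN]; first by rewrite h ?extend_wordE.
by rewrite (h (Ordinal jN)) -extend_wordE.
Qed.

Lemma preimage_cylinder N (w : forall j : 'I_N, 'I_(b j).+1) :
  digits @^-1` cylinder w `&` `[0, 1[ =
  [set` `[cyl_start (extend_word w) N, cyl_start (extend_word w) N +
            cyl_length (extend_word w) N[%R].
Proof.
have [s0 s1] := cyl_interval_sub (extend_word w) N.
apply/seteqP; split=> y /=; rewrite !in_itv /=.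
  by move=> [/extend_word_forall + y01] => /(cylinder_interval _ _ y01).1.
move=> h; have y01 : 0 <= y < 1 by case/andP: h => *; apply/andP; split; lra.
split => //; apply/extend_word_forall; exact/(cylinder_interval _ _ y01).1.
Qed.

Lemma measurable_digits : measurable_fun [set: measurableTypeR R] digits.
Proof.
apply: (@measurability _ _ (measurableTypeR R) (product_space b) setT digits (@cylinders b)) => // _ [_ [N [w ->]] <-].
rewrite setTI -[X in measurable X](setUIDK _ `[0, 1[).
apply: measurableU; first by rewrite preimage_cylinder; exact: measurable_itv.
(* Off [0,1[ all digits are [ord0], so there the preimage is everything or nothing. *)
have [w0|w0] := pselect (cylinder w (fun=> ord0)).
  rewrite (_ : _ `\` _ = ~` `[0, 1[); first by apply: measurableC; exact: measurable_itv.
  apply/seteqP; split=> y /=; first by case.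
  rewrite in_itv /= => /negP y01; split; last exact/negP.
  by move=> j; rewrite /digits (negbTE y01); exact: w0.
rewrite (_ : _ `\` _ = set0)//; apply/seteqP; split=> y //= [+ /negP].
rewrite in_itv /= => h y01; apply: w0 => j.
by have := h j; rewrite /digits (negbTE y01).
Qed.

Lemma product_measure_exists :
  exists P : probability (product_space b) R, product_measure q P.
Proof.
(* The restricted measure already has mass 1; normalizing changes nothing and supplies the structure
   of a probability. *)
pose lam : probability (measurableTypeR R) R :=
  mnormalize (mrestr lebesgue_measure (measurable_itv `[(0 : R), 1[))
    point.
have lamE A : lam A = lebesgue_measure (A `&` `[0, 1[).
  have E1 : lebesgue_measure ([set: measurableTypeR R] `&` `[0, 1[) = 1%E.
    by rewrite setTI lebesgue_measure_itv /= lte_fin ltr01 oppr0 adde0.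
  by rewrite /lam /= /mnormalize /= /mrestr E1 onee_eq0 /= invr1 mule1.
pose X : {mfun measurableTypeR R >-> product_space b} :=
  HB.pack digits (isMeasurableFun.Build _ _ _ _ _ measurable_digits).
exists (distribution lam X) => N w.
rewrite [LHS](lamE (digits @^-1` cylinder w)) preimage_cylinder lebesgue_measure_itv /=.
rewrite lte_fin ltrDl cyl_length_gt0 -EFinB addrC addKr.
by congr _%:E; apply: eq_bigr => j _; rewrite extend_wordE.
Qed.

End product_measure_exists.

Section ffun_cons.
Variables (T : finType) (N : nat).

Definition fcons (i : T) (w : {ffun 'I_N -> T}) : {ffun 'I_N.+1 -> T} :=
  [ffun j => if unlift ord0 j is Some j' then w j' else i].

Lemma fcons0 i w : fcons i w ord0 = i.
Proof. by rewrite ffunE unlift_none. Qed.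

Lemma fconsS i w j : fcons i w (lift ord0 j) = w j.
Proof. by rewrite ffunE liftK. Qed.

Lemma sum_fcons (V : nmodType) (F : {ffun 'I_N.+1 -> T} -> V) :
  \sum_w F w = \sum_i \sum_w F (fcons i w).
Proof.
rewrite pair_big /=; apply: (reindex (fun p : T * _ => fcons p.1 p.2)).
exists (fun w : {ffun 'I_N.+1 -> T} => (w ord0, [ffun j : 'I_N => w (lift ord0 j)])) => [[i w] _|w _] /=.
  by rewrite fcons0; congr (_, _); apply/ffunP => j; rewrite ffunE fconsS.
apply/ffunP => j; case: (unliftP ord0 j) => [j'|] ->.
  by rewrite fconsS ffunE.
by rewrite fcons0.
Qed.

Lemma prod_fcons (V : pzSemiRingType) (F : T -> V) i w :
  \prod_j F (fcons i w j) = F i * \prod_j F (w j).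
Proof.
rewrite big_ord_recl fcons0; congr (_ * _).
by apply: eq_bigr => j _; rewrite fconsS.
Qed.

End ffun_cons.

(* The two types are convertible but their enumerations are not. *)
Lemma sum_dffun_ffun (V : nmodType) (I J : finType) (F : {ffun I -> J} -> V) :
  \sum_(w : {dffun forall _ : I, J}) F w = \sum_(w : {ffun I -> J}) F w.
Proof.
apply: (reindex (fun w : {ffun I -> J} => w : {dffun forall _ : I, J})).
by exists (fun w : {dffun forall _ : I, J} => w : {ffun I -> J}).
Qed.

(** * Functions of finitely many letters; uniqueness of product measures *)

Section product_space_theory.
Variable b : nat -> nat.
Local Notation finite_word N := {dffun forall j : 'I_N, 'I_(b j).+1}.

Definition restr N (v : product_space b) : finite_word N := [ffun j : 'I_N => v j].

Lemma restr_cylinder N (w : finite_word N) (v : product_space b) :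
  restr N v = w <-> cylinder w v.
Proof.
split=> [<- j|h]; first by rewrite ffunE.
by apply/ffunP => j; rewrite ffunE; exact: h.
Qed.

Lemma measurable_restr N (Y : set (finite_word N)) :
  measurable (restr N @^-1` Y : set (product_space b)).
Proof.
rewrite (_ : _ @^-1` _ = \bigcup_(w in Y) cylinder w); last first.
  apply/seteqP; split=> [v /= Yv|v [w Yw /restr_cylinder vw]]; last by rewrite /= vw.
  by exists (restr N v) => //; exact/restr_cylinder.
apply: fin_bigcup_measurable => [|w _]; first exact: finite_finset.
by apply: sub_sigma_algebra; exists N, w.
Qed.

Lemma measurable_fun_restr N d (T : measurableType d) (G : finite_word N -> T) :
  measurable_fun [set: product_space b] (fun v => G (restr N v)).
Proof. by move=> _ Y _; rewrite setTI; exact: (measurable_restr (G @^-1` Y)). Qed.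

Section law.
Variables (R : realType) (P : probability (product_space b) R).
Variable q : forall j, 'I_(b j).+1 -> R.
Local Arguments q : clear implicits.
Hypothesis Pq : product_measure q P.

Lemma integral_restr N (G : finite_word N -> R) : (forall w, 0 <= G w) ->
  (\int[P]_v (G (restr N v))%:E)%E =
  (\sum_(w : finite_word N) (\prod_(j < N) q j (w j)) * G w)%:E.
Proof.
move=> G0.
rewrite (eq_integral (fun v : product_space b => \sum_(w : finite_word N) (G w)%:E * (\1_(cylinder w) v)%:E)%E); last first.
  move=> v _; rewrite (bigD1 (restr N v))//= big1 ?adde0 => [|w wv].
    rewrite indicE mem_set ?mule1//; exact/restr_cylinder.
  rewrite indicE memNset ?mule0// => /restr_cylinder vw.
  by rewrite vw eqxx in wv.
have mcyl (w : finite_word N) : measurable (cylinder w : set (product_space b)).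
  by apply: sub_sigma_algebra; exists N, w.
rewrite ge0_integral_sum//.
- rewrite -sumEFin; apply: eq_bigr => w _.
  rewrite ge0_integralZl//.
  + rewrite integral_indic// setIT.
    by transitivity ((G w)%:E * P (cylinder w))%E => //; rewrite Pq -EFinM mulrC.
  + by apply/measurable_EFinP; exact: measurable_indic.
  + by rewrite lee_fin.
- move=> w; apply: emeasurable_funM; first exact: measurable_cst.
  by apply/measurable_EFinP; exact: measurable_indic.
- by move=> w v _; rewrite mule_ge0 ?lee_fin.
Qed.

Lemma measure_restr N (Y : pred (finite_word N)) :
  P (restr N @^-1` [set w | Y w]) =
  (\sum_(w : finite_word N) (\prod_(j < N) q j (w j)) * (Y w)%:R)%:E.
Proof.
rewrite -integral_restr => [|w]; last by rewrite ler0n.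
rewrite -[X in P X]setIT -integral_indic//; last exact: measurable_restr.
apply: eq_integral => v _; rewrite indicE; congr (_%:R)%:E.
by rewrite (_ : (v \in _) = Y (restr N v))//; apply/idP/idP; rewrite inE.
Qed.

End law.

(** Cylinders form a pi-system once the empty set is added, since two of them may be disjoint. *)
Lemma product_measure_unique (R : realType) (P1 P2 : probability (product_space b) R) :
  (forall N (w : forall j : 'I_N, 'I_(b j).+1), P1 (cylinder w) = P2 (cylinder w)) ->
  forall A, measurable A -> P1 A = P2 A.
Proof.
move=> P12; have cylT : cylinder (fun j : 'I_0 => ord0 : 'I_(b j).+1) = [set: seq_space b].
  by apply/seteqP; split=> // v _ [].
move=> S mS.
apply: (@measure_unique _ R (product_space b) (@cylinders b `|` [set set0])
  (fun=> setT) _ _ _ _ P1 P2) mS.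
- apply/seteqP; split; apply: smallest_sub; try exact: smallest_sigma_algebra.
    by move=> A cA; apply: sub_sigma_algebra; left.
  move=> A [cA|->]; first exact: sub_sigma_algebra.
  exact: (@measurable0 _ (product_space b)).
- move=> A B [[N [w ->]]|->]; last by rewrite set0I; right.
  move=> [[M [w' ->]]|->]; last by rewrite setI0; right.
  have [[v [vw vw']]|h] := pselect (cylinder w `&` cylinder w' !=set0); last first.
    by right; exact/nonemptyPn.
  (* Two cylinders with a common point [v] meet in the cylinder around [v] of the larger length. *)
  left; exists (maxn N M), (fun j => v j); apply/seteqP; split=> u /=.
    move=> [uw uw'] j.
    have [jN|Nj] := ltnP j N; first by rewrite (uw (Ordinal jN)) (vw (Ordinal jN)).
    have jM : (j < M)%N by have := ltn_ord j; rewrite leq_max ltnNge Nj.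
    by rewrite (uw' (Ordinal jM)) (vw' (Ordinal jM)).
  move=> uv; split=> j.
    by rewrite (uv (widen_ord (leq_maxl N M) j)) -vw.
  by rewrite (uv (widen_ord (leq_maxr N M) j)) -vw'.
- by move=> _; left; exists 0%N, (fun=> ord0); exact/esym/cylT.
- by rewrite bigcup_const//; exists 0%N.
- move=> A [[N [w ->]]|->]; first exact: P12.
  by rewrite !measure0.
- by move=> _; rewrite [ltLHS]probability_setT ltey.
Qed.

End product_space_theory.

(** It suffices to test cylinders. The shifted preimage of one leaves the first letter free, and
    summing over that letter gives the factor 1. *)
Lemma iid_shift_invariant (R : realType) l (q : 'I_l.+1 -> R)
    (P : probability (omega_space l) R) : \sum_i q i = 1 ->
  product_measure (fun=> q) P ->
  forall A, measurable A -> P (@left_shift l @^-1` A) = P A.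
Proof.
move=> q1 Pq.
have shiftE N (w : forall j : 'I_N, 'I_l.+1) :
    @left_shift l @^-1` cylinder w =
    restr (b := fun=> l) N.+1 @^-1` [set w' | [forall j : 'I_N, w' (lift ord0 j) == w j]].
  apply/seteqP; split=> [v vw|v /forallP vw j] /=.
    by apply/forallP => j; rewrite ffunE; apply/eqP; exact: vw.
  by have := vw j; rewrite ffunE => /eqP.
have mshift : measurable_fun [set: omega_space l] (@left_shift l).
  apply: (@measurability _ _ (omega_space l) (omega_space l) _ _ (@cylinders (fun=> l))) => //.
  by move=> _ [_ [N [w ->]] <-]; rewrite setTI shiftE; exact: measurable_restr.
pose X : {mfun omega_space l >-> omega_space l} :=
  HB.pack (@left_shift l) (isMeasurableFun.Build _ _ _ _ _ mshift).
apply: (@product_measure_unique _ _ (distribution P X) P) => N w.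
rewrite [LHS](_ : _ = P (@left_shift l @^-1` cylinder w))// shiftE.
rewrite (measure_restr Pq) Pq; congr _%:E.
rewrite -[RHS]mul1r -[X in _ = X * _]q1 mulr_suml.
transitivity (\sum_(w' : {ffun 'I_N.+1 -> 'I_l.+1})
  (\prod_j q (w' j)) * ([forall j, w' (lift ord0 j) == w j])%:R).
  exact: (@sum_dffun_ffun _ _ _ (fun w' : {ffun 'I_N.+1 -> 'I_l.+1} =>
    (\prod_j q (w' j)) * ([forall j, w' (lift ord0 j) == w j])%:R)).
rewrite sum_fcons; apply: eq_bigr => i _.
rewrite (bigD1 (finfun w))//= [X in _ + X]big1 ?addr0 => [|w' w'w].
  rewrite (prod_fcons q) (_ : [forall j, _]) ?mulr1; last first.
    by apply/forallP => j; rewrite fconsS ffunE.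
  by congr (_ * _); apply: eq_bigr => j _; rewrite ffunE.
case: forallP => [h|]; rewrite ?mulr0//.
by case/eqP: w'w; apply/ffunP => j; rewrite ffunE; have := h j; rewrite fconsS => /eqP.
Qed.

(** * Sums over words and the transfer operator *)

Section weighted_words.
Variables (A : comPzRingType) (n k : nat).
Local Notation I := 'I_n.
Local Notation J := 'I_k.
Variable p : I -> A.

(** Nested sums rather than a sum over a type of words, so that induction on [N] is immediate;
    ring-valued to serve real and complex weights alike. *)
Fixpoint word_sum N (G : seq I -> A) : A :=
  if N is N'.+1 then \sum_a p a * word_sum N' (fun s => G (a :: s)) else G [::].

Lemma eq_word_sum N G G' : G =1 G' -> word_sum N G = word_sum N G'.
Proof.
elim: N G G' => [|N IH] G G' GG' /=; first exact: GG'.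
by apply: eq_bigr => a _; congr (_ * _); apply: IH => s; exact: GG'.
Qed.

Lemma word_sum_linear N (G : I -> seq I -> A) :
  word_sum N (fun s => \sum_a p a * G a s) = \sum_a p a * word_sum N (G a).
Proof.
elim: N G => //= N IH G.
under eq_bigr do rewrite IH mulr_sumr.
rewrite exchange_big; apply: eq_bigr => a _; rewrite mulr_sumr.
by apply: eq_bigr => b _; rewrite mulrCA.
Qed.

Variables (q : I -> A) (wt : I -> J -> A) (tri : I -> J -> I).
Hypothesis disintegrate : forall G : I -> A,
  \sum_i q i * \sum_j wt i j * G (tri i j) = \sum_a p a * G a.

(** The one-letter identity is applied letter by letter, after splitting off the first letters of
    [w] and [v]. Indicators of tails give the disintegration of the measure, twisted terms that of
    the operator. *)
Lemma word_sum_disintegrate N (G : seq I -> A) :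
  \sum_(w : {ffun 'I_N -> I}) (\prod_j q (w j)) *
    \sum_(v : {ffun 'I_N -> J}) (\prod_j wt (w j) (v j)) *
      G [seq tri (w j) (v j) | j <- enum 'I_N] = word_sum N G.
Proof.
elim: N G => [|N IH] G /=.
  have ffun0_unique (T : finType) (w w' : {ffun 'I_0 -> T}) : w = w'.
    by apply/ffunP => -[].
  have sum0 (T : finType) (F : {ffun 'I_0 -> T} -> A) (w0 : {ffun 'I_0 -> T}) :
      \sum_w F w = F w0.
    rewrite (bigD1 w0)//= big1 ?addr0// => w; by rewrite (ffun0_unique _ w w0) eqxx.
  rewrite (sum0 _ _ (ffun0 (card_ord 0))) (sum0 _ _ (ffun0 (card_ord 0))).
  by rewrite !big_ord0 !mul1r; congr (G _); apply/size0nil; rewrite size_map size_enum_ord.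
rewrite -disintegrate sum_fcons; apply: eq_bigr => i _.
under eq_bigr => w _.
  rewrite prod_fcons sum_fcons -mulrA mulr_sumr; over.
rewrite -mulr_sumr; congr (_ * _); rewrite exchange_big /=; apply: eq_bigr => j _.
rewrite -IH mulr_sumr; apply: eq_bigr => w _.
rewrite mulrCA; congr (_ * _); rewrite mulr_sumr; apply: eq_bigr => v _.
rewrite big_ord_recl !fcons0 -mulrA; congr (_ * (_ * _)).
  by apply: eq_bigr => l _; rewrite !fconsS.
rewrite enum_ordSl /= !fcons0 -map_comp; congr (G (_ :: _)).
by apply: eq_map => l /=; rewrite !fconsS.
Qed.

End weighted_words.

(** * Iterates of the transfer operator as sums over words *)

Section transfer_words.
Variables (R : realType) (n : nat) (f : 'I_n -> R -> R) (p : 'I_n -> R).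
Hypothesis f_ifs : C2_ifs f.
Local Notation W := (word_map f).

Lemma cexpD (y z : R[i]) : cexp (y + z) = cexp y * cexp z.
Proof.
case: y z => [a b] [c d]; rewrite /cexp /= expRD cosD sinD.
by apply/eqP; rewrite eq_complex /=; apply/andP; split; apply/eqP; ring.
Qed.

Lemma twistD (s : R[i]) t t' : twist s (t + t') = twist s t * twist s t'.
Proof. by rewrite /twist -cexpD -mulrDl -raddfD/= mulrDr. Qed.

Lemma twist0 (s : R[i]) : twist s 0 = 1.
Proof.
rewrite /twist mulr0; case: s => a b; rewrite /cexp /= !mul0r subrr addr0.
by rewrite expR0 cos0 sin0 mulr0 mulr1.
Qed.

Lemma cocycle_cat s t x : x \in `[0, 1] ->
  cocycle (W (s ++ t)) x = cocycle (W s) (W t x) + cocycle (W t) x.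
Proof. by move=> xU; rewrite /cocycle (log_abs_deriv_cat f_ifs)// opprD. Qed.

Lemma iter_transfer N (s : R[i]) (g : R -> R[i]) x : x \in `[0, 1] ->
  iter N (transfer f p s) g x =
  word_sum (fun a => (p a)%:C%C) N
    (fun t => twist s (cocycle (W t) x) * g (W t x)).
Proof.
move=> xU; elim: N g => [|N IH] g /=.
  rewrite /cocycle /log_abs_deriv [D01 _ _](D01_word_nil f xU) normr1 ln1 oppr0 twist0.
  by rewrite mul1r.
(* The copy of the operator applied first to [g] prepends a letter to [t], and the cocycle identity
   merges the two twists. *)
rewrite -iterS iterSr IH -word_sum_linear; apply: eq_word_sum => t.
rewrite /transfer mulr_sumr; apply: eq_bigr => a _.
rewrite [cocycle (f a \o W t) x](@cocycle_cat [:: a] t x xU) twistD.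
by rewrite [cocycle (W [:: a])]/(cocycle (f a)) /=; ring.
Qed.

End transfer_words.

Lemma word_map_big (R : realType) n (f : 'I_n -> R -> R) (T : Type) (r : seq T) (a : T -> 'I_n) :
  word_map f [seq a j | j <- r] =
  \big[(fun g h => g \o h)/idfun]_(j <- r) f (a j).
Proof. by elim: r => [|j r IH]; rewrite ?big_nil// big_cons -IH. Qed.

Lemma word_map_big_ord (R : realType) n (f : 'I_n -> R -> R) N (a : 'I_N -> 'I_n) :
  \big[(fun g h => g \o h)/idfun]_(j < N) f (a j) =
  word_map f [seq a j | j <- enum 'I_N].
Proof. by rewrite word_map_big enumT; congr bigop.body; rewrite /index_enum unlock. Qed.

Lemma map_enum_mkseq (T : Type) N (a : nat -> T) :
  [seq a j | j : 'I_N <- enum 'I_N] = mkseq a N.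
Proof. by rewrite /mkseq -val_enum_ord -map_comp. Qed.

(** * Comparison of measures by their tails *)

Section mixture.
Variables (R : realType) (d : measure_display) (T : measurableType d).
Variables (P : probability T R) (mu : T -> probability (measurableTypeR R) R).
Variable nu : probability (measurableTypeR R) R.
Local Open Scope ereal_scope.

Lemma integrable_probability A : measurable A ->
  measurable_fun setT (fun w => mu w A) -> P.-integrable setT (fun w => mu w A).
Proof.
move=> mA mf; apply: (le_integrable _ mf) (finite_measure_integrable_cst P 1 _) => //.
by move=> w _ /=; rewrite normr1 gee0_abs// probability_le1.
Qed.

(* By the pi-lambda theorem the upper half-lines suffice. *)
Lemma mixture_of_tails :
  (forall t : R, measurable_fun setT (fun w => mu w `]t, +oo[%classic)) ->
  (forall t : R, nu `]t, +oo[%classic = \int[P]_w mu w `]t, +oo[%classic) ->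
  forall A, measurable A ->
    measurable_fun setT (fun w => mu w A) /\ nu A = \int[P]_w mu w A.
Proof.
move=> mtail Etail A mA.
have mE : measurable = <<s @RGenOInfty.G R >> by exact: RGenOInfty.measurableE.
have sA : <<s @RGenOInfty.G R >> A by rewrite -mE.
have int1 : \int[P]_w cst 1 w = 1.
  by rewrite integral_cst// mul1e; exact: probability_setT.
move: A sA {mA}.
apply: (@dynkin_induction _ (measurableTypeR R) (@RGenOInfty.G R)
  (fun A => measurable_fun setT (fun w => mu w A) /\ nu A = \int[P]_w mu w A)) => //.
- move=> _ _ [x ->] [y ->]; exists (Num.max x y).
  apply/seteqP; split=> z /=; rewrite !in_itv /= !andbT gt_max; first by move=> [-> ->].
  by move=> /andP[].
- rewrite [nu _]probability_setT.
  rewrite (_ : (fun w => mu w setT) = cst 1); last first.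
    by apply/funext => w; exact: probability_setT.
  split; first exact: measurable_cst.
  exact: esym int1.
- by move=> _ [t ->].
- move=> S mS [mf E].
  rewrite (_ : (fun w => mu w (~` S)) = (cst 1 \- fun w => mu w S)); last first.
    by apply/funext => w /=; rewrite probability_setC.
  split; first exact: emeasurable_funB.
  rewrite integralB//; first last.
  + exact: integrable_probability.
  + exact: finite_measure_integrable_cst.
  by rewrite int1 probability_setC// E.
- move=> F mF tF IH.
  rewrite (_ : (fun w => mu w (\bigcup_k F k)) = (fun w => \sum_(k <oo) mu w (F k))); last first.
    by apply/funext => w; rewrite measure_semi_bigcup//; exact: bigcup_measurable.
  split.
    have := @ge0_emeasurable_sum _ T R setT (fun k w => mu w (F k)) predT.
    by apply => // k _; exact: (IH k).1.
  rewrite integral_nneseries//; last by move=> k; exact: (IH k).1.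
  rewrite measure_semi_bigcup//; last by apply: bigcup_measurable => k _; exact: mF.
  by apply: eq_eseriesr => k _; exact: (IH k).2.
Qed.

End mixture.

Section tails.
Variables (R : realType) (e : nat -> R).
Hypothesis e_ge0 : forall N, 0 <= e N.
Hypothesis e_noninc : nonincreasing_seq e.
Hypothesis e_cvg0 : e N @[N --> \oo] --> (0 : R).
Local Open Scope ereal_scope.

(** Closeness in the manner of the Lévy distance, with a horizontal error only. *)
Definition tail_approx (m : probability (measurableTypeR R) R) (F : nat -> R -> R) :=
  forall N t, m `](t + e N)%R, +oo[%classic <= (F N t)%:E /\
    (F N (t + e N))%:E <= m `]t, +oo[%classic.

(** Evaluated at [t + e N], the approximation lies between the tails of [m] at [t + 2 * e N] and at
    [t]. The open rays increase to the ray at [t], so a possible atom at [t] does no harm. *)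
Lemma tail_approx_cvg m F : tail_approx m F -> forall t : R,
  (F N (t + e N))%:E @[N --> \oo] --> m `]t, +oo[%classic.
Proof.
move=> mF t.
have tailE : `]t, +oo[%classic = \bigcup_N `](t + e N + e N)%R, +oo[%classic.
  apply/seteqP; split=> x /=; last first.
    move=> [N _ /=]; rewrite !in_itv /= !andbT; apply: le_lt_trans.
    by rewrite -addrA lerDl addr_ge0.
  rewrite in_itv /= andbT -subr_gt0 => xt.
  have /cvgr0Pnorm_lt/(_ ((x - t) / 2)%R) := e_cvg0.
  rewrite divr_gt0// => /(_ isT)[N _ /(_ N (leqnn N))]; rewrite ger0_norm// => eN.
  by exists N => //=; rewrite in_itv /= andbT; lra.
apply: (@squeeze_cvge _ _ _ _ (fun N => m `](t + e N + e N)%R, +oo[%classic) _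
  (cst (m `]t, +oo[%classic))).
- by apply: nearW => N; rewrite (mF N (t + e N)%R).1 (mF N t).2.
- rewrite tailE; apply: nondecreasing_cvg_mu.
  + by move=> N; exact: measurable_itv.
  + by apply: bigcup_measurable => N _; exact: measurable_itv.
  + move=> N M NM; apply/subsetPset => x /=; rewrite !in_itv /= !andbT.
    by apply: le_lt_trans; rewrite lerD ?lerD2l// e_noninc.
- exact: cvg_cst.
Qed.

(** The mixture identity holds exactly at each finite level; dominated convergence and uniqueness of
    limits carry it to the tails of the measures. *)
Lemma mixture_of_tail_approx d (T : measurableType d) (P : probability T R)
    (mu : T -> probability (measurableTypeR R) R)
    (nu : probability (measurableTypeR R) R)
    (H : T -> nat -> R -> R) (F : nat -> R -> R) :
  (forall w N t, (0 <= H w N t)%R) ->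
  (forall w, tail_approx (mu w) (H w)) -> tail_approx nu F ->
  (forall N t, measurable_fun setT (fun w => H w N t)) ->
  (forall N t, \int[P]_w (H w N t)%:E = (F N t)%:E) ->
  forall A, measurable A ->
    measurable_fun setT (fun w => mu w A) /\ nu A = \int[P]_w mu w A.
Proof.
move=> H0 muH nuF mH EH.
have mtail t : measurable_fun setT (fun w => mu w `]t, +oo[%classic).
  apply: (emeasurable_fun_cvg (fun N w => (H w N (t + e N))%:E)).
    by move=> N; apply/measurable_EFinP.
  by move=> w _; exact: tail_approx_cvg.
apply: mixture_of_tails => // t.
have cF := @tail_approx_cvg _ _ nuF t.
have cH : (\int[P]_w (H w N (t + e N))%:E) @[N --> \oo] --> \int[P]_w mu w `]t, +oo[%classic.
  apply: (@dominated_cvg _ _ _ _ setT measurableT _ _ (cst 1)) => //.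
  - by move=> N; apply/measurable_EFinP.
  - by move=> w _; exact: tail_approx_cvg.
  - exact: finite_measure_integrable_cst.
  - move=> N w _; rewrite gee0_abs; last by rewrite lee_fin.
    by apply: (le_trans (muH w N t).2); apply: probability_le1; exact: measurable_itv.
have EF : (fun N => \int[P]_w (H w N (t + e N))%:E) = (fun N => (F N (t + e N))%:E).
  by apply/funext => N; exact: EH.
rewrite EF in cH; exact: (cvg_unique (@ereal_hausdorff R) cF cH).
Qed.

End tails.

Section word_sum_le.
Variables (R : realType) (n : nat) (p : 'I_n -> R).
Hypothesis p_ge0 : forall a, 0 <= p a.

Lemma word_sum_le N (G G' : seq 'I_n -> R) :
  (forall s, size s = N -> G s <= G' s) -> word_sum p N G <= word_sum p N G'.
Proof.
elim: N G G' => [|N IH] G G' GG' /=; first exact: GG'.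
apply: ler_sum => a _; rewrite ler_wpM2l// IH// => s sN.
by apply: GG'; rewrite /= sN.
Qed.

Lemma word_sum_ge0 N (G : seq 'I_n -> R) :
  (forall s, 0 <= G s) -> 0 <= word_sum p N G.
Proof.
elim: N G => [|N IH] G G0 //=; apply: sumr_ge0 => a _.
by rewrite mulr_ge0// IH.
Qed.

End word_sum_le.

(** * Finite-level bounds for a self-conformal measure *)

Section self_conformal_tails.
Variables (R : realType) (n : nat) (f : 'I_n -> R -> R) (p : 'I_n -> R).
Variable nu : probability (measurableTypeR R) R.
Hypothesis f_ifs : C2_ifs f.
Hypothesis p_ge0 : forall a, 0 <= p a.
Hypothesis nu_self : self_conformal f p nu.
Local Notation U := (unit_itv R).
Local Notation W := (word_map f).
Local Notation rho := (contraction_rate f).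

Lemma measurable_ifs_preimage a (B : set R) : measurable B ->
  measurable (U `&` f a @^-1` B).
Proof.
move=> mB; have : measurable_fun (U : set (measurableTypeR R)) (f a).
  apply: subspace_continuous_measurable_fun; first exact: measurable_itv.
  apply/subspace_continuousP => x xU.
  exact: (deriv_within_cvg (ifs_deriv f_ifs a xU)).
by apply => //; exact: measurable_itv.
Qed.

(** Iterating self-conformality, only words whose image of [0,1] meets [B] contribute. The base case
    uses that [nu] gives no mass to the complement of [0,1]. *)
Lemma self_conformal_le N (B : set R) : measurable B ->
  (nu B <= (word_sum p N (fun s => (`[< (B `&` (W s @` U)) !=set0 >])%:R))%:E)%E.
Proof.
elim: N B => [|N IH] B mB /=.
  case: asboolP => [_|/= h]; first exact: probability_le1.
  have : (nu B <= nu (~` U))%E.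
    apply: le_measure; rewrite ?inE//; first by apply: measurableC; exact: measurable_itv.
    by move=> x Bx Ux; apply: h; exists x; split=> //; exists x.
  rewrite probability_setC; last exact: measurable_itv.
  by move=> /le_trans; apply; rewrite nu_self.1 subee.
rewrite nu_self.2// -sumEFin; apply: lee_sum => a _; rewrite EFinM.
apply: lee_pmul => //; first by rewrite lee_fin.
apply: le_trans (IH _ (measurable_ifs_preimage a mB)) _; rewrite lee_fin.
apply: word_sum_le => // s _; rewrite ler_nat.
case: asboolP => // -[x [[xU Bx] [y yU yx]]]; case: asboolP => // h; exfalso; apply: h.
by exists (f a x); split=> //; exists y; rewrite //= yx.
Qed.

Lemma self_conformal_ge N (B : set R) : measurable B ->
  ((word_sum p N (fun s => (`[< W s @` U `<=` B >])%:R))%:E <= nu B)%E.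
Proof.
elim: N B => [|N IH] B mB /=.
  case: asboolP => [h|/= _]; last exact: measure_ge0.
  have mU : measurable (U : set (measurableTypeR R)) by exact: measurable_itv.
  have /= := le_measure nu (mem_set mU) (mem_set mB); rewrite nu_self.1; apply.
  by move=> x Ux; apply: h; exists x.
rewrite nu_self.2// -sumEFin; apply: lee_sum => a _; rewrite EFinM.
apply: lee_pmul => //; first by rewrite lee_fin.
  by rewrite lee_fin word_sum_ge0// => s; rewrite ler0n.
apply: (le_trans _ (IH _ (measurable_ifs_preimage a mB))); rewrite lee_fin.
apply: word_sum_le => // s _; rewrite ler_nat.
case: asboolP => // h; case: asboolP => // h'; exfalso; apply: h' => x [y yU <-].
by split; [exact: word_unit | apply: h; exists y].
Qed.

(** The image of [0,1] under a word of length [N] stays within [rho ^+ N] of the image of 0, so that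
    one point decides, up to a shift, whether the image lies above [t]. *)
Lemma self_conformal_tail_approx :
  tail_approx (fun N => rho ^+ N) nu
    (fun N t => word_sum p N (fun s => (t < W s 0)%R%:R)).
Proof.
have U0 : (0 : R) \in `[0, 1] by rewrite in_itv /= lexx ler01.
move=> N t; split.
  apply: le_trans (self_conformal_le N _) _; first exact: measurable_itv.
  rewrite lee_fin; apply: word_sum_le => // s sN; rewrite ler_nat.
  case: asboolP => // -[z [+ [x xU xz]]]; rewrite /= in_itv /= andbT -xz => tx.
  have := word_lipschitz f_ifs s xU U0; rewrite sN ler_norml => /andP[_ h].
  by rewrite (_ : (t < W s 0)%R = true)//; lra.
apply: (le_trans _ (self_conformal_ge N _)); last exact: measurable_itv.
rewrite lee_fin; apply: word_sum_le => // s sN; rewrite ler_nat.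
case: ltP => // tx; case: asboolP => // h; exfalso; apply: h => _ [x xU <-].
have := word_lipschitz f_ifs s xU U0; rewrite sN ler_norml => /andP[h _].
by rewrite /= in_itv /= andbT; lra.
Qed.

End self_conformal_tails.

(** * Fibers *)

Section random_coding.
Variables (R : realType) (n k : nat) (f : 'I_n -> R -> R) (Ct : R).
Hypothesis f_ifs : C2_ifs f.
Hypothesis f_dist : distortion_bound f Ct.
Variables (tri : 'I_n -> 'I_k.+1 -> 'I_n) (wt : 'I_n -> 'I_k.+1 -> R).
Hypothesis wt_gt0 : forall i j, 0 < wt i j.
Hypothesis wt_sum : forall i, \sum_j wt i j = 1.
Local Notation U := (unit_itv R).
Local Notation rho := (contraction_rate f).
Local Notation W := (word_map f).
Local Notation space := (product_space (fun=> k)).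

Definition letters (w : nat -> 'I_n) (u : space) (j : nat) : 'I_n := tri (w j) (u j).

Definition fin_letters N (w : 'I_N -> 'I_n) (v : 'I_N -> 'I_k.+1) : seq 'I_n :=
  [seq tri (w j) (v j) | j <- enum 'I_N].

Lemma mkseq_letters w u N :
  mkseq (letters w u) N = fin_letters (w \o @nat_of_ord N) (restr N u).
Proof.
by rewrite -map_enum_mkseq; apply: eq_map => j; rewrite /letters /= ffunE.
Qed.

Definition point_of w (u : space) : R := coded f (letters w u).

Lemma measurable_point_of w : measurable_fun [set: space] (point_of w).
Proof.
apply: (@measurable_fun_cvg _ _ _ _ (fun N u => W (mkseq (letters w u) N) 0)).
  move=> N.
  rewrite (_ : (fun u : space => _) =
      (fun u => W (fin_letters (w \o @nat_of_ord N) (restr N u)) 0)); last first.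
    by apply/funext => u; rewrite mkseq_letters.
  exact: (@measurable_fun_restr (fun=> k) N _ (measurableTypeR R)
    (fun v => W (fin_letters (w \o @nat_of_ord N) v) 0)).
by move=> u _; exact: coded_cvg.
Qed.

(** The law of the level-[N] approximation under the fiber measure, written as a finite sum so that
    it visibly depends on the first [N] letters of [w] only. *)
Definition tail_sum (w : nat -> 'I_n) N (t : R) : R :=
  \sum_(v : {ffun 'I_N -> 'I_k.+1}) (\prod_(j < N) wt (w j) (v j)) *
    (t < W (fin_letters (w \o @nat_of_ord N) v) 0)%R%:R.

Section fiber.
Variables (w : nat -> 'I_n) (eta : probability space R).
Hypothesis eta_prod : product_measure (fun j => wt (w j)) eta.
Variable mu : probability (measurableTypeR R) R.
Hypothesis muE : forall A, measurable A -> mu A = eta (point_of w @^-1` A).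

Lemma measurable_preimage_point A : measurable A ->
  measurable (point_of w @^-1` A : set space).
Proof. by move=> mA; rewrite -[X in measurable X]setTI; exact: measurable_point_of. Qed.

Lemma tail_sumE N t : (tail_sum w N t)%:E =
  eta [set u | t < W (mkseq (letters w u) N) 0].
Proof.
transitivity (eta (restr N @^-1` [set v | t < W (fin_letters (w \o @nat_of_ord N) v) 0])).
  rewrite (measure_restr eta_prod (N := N)
    (fun v => t < W (fin_letters (w \o @nat_of_ord N) v) 0)).
  congr _%:E; rewrite /tail_sum -[LHS]sum_dffun_ffun; apply: eq_bigr => v _.
by congr (eta _); apply/seteqP; split=> u /=; rewrite mkseq_letters.
Qed.

Lemma measurable_tail N t :
  measurable ([set u | t < W (mkseq (letters w u) N) 0] : set space).
Proof.
rewrite [X in measurable X](_ : _ = restr N @^-1` [set v | t < W (fin_letters (w \o @nat_of_ord N) v) 0]).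
  exact: measurable_restr.
by apply/seteqP; split=> u /=; rewrite mkseq_letters.
Qed.

Lemma fiber_tail_approx : tail_approx (fun N => rho ^+ N) mu (tail_sum w).
Proof.
move=> N t; rewrite !tail_sumE !muE; last first.
- exact: measurable_itv.
- exact: measurable_itv.
have mpre (s : R) : measurable (point_of w @^-1` `]s, +oo[ : set space).
  by apply: measurable_preimage_point; exact: measurable_itv.
split; apply: le_measure; rewrite ?inE; try exact: mpre; try exact: measurable_tail.
all: move=> u /=; rewrite in_itv /= andbT.
all: have := coded_prefix_dist f_ifs (letters w u) N; rewrite ler_norml => /andP[h1 h2].
all: by rewrite /point_of; lra.
Qed.

Lemma eta_cylinder N (u : space) :
  eta (cylinder (fun j : 'I_N => u j)) = (\prod_(j < N) wt (w j) (u j))%:E.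
Proof. exact: eta_prod. Qed.

Lemma measurable_cylinder N (u : space) :
  measurable (cylinder (fun j : 'I_N => u j) : set space).
Proof. by apply: sub_sigma_algebra; exists N; eexists. Qed.

Variables (d wmin wmax : R).
Hypothesis d_gt0 : 0 < d.
Hypothesis gap : forall i j j', j != j' -> forall x y, x \in `[0, 1] -> y \in `[0, 1] ->
  d <= `|f (tri i j) x - f (tri i j') y|.
Hypothesis wmin_gt0 : 0 < wmin.
Hypothesis wmin_le : forall i j, wmin <= wt i j.
Hypothesis wmax_lt1 : wmax < 1.
Hypothesis wmax_ge : forall i j, wt i j <= wmax.
Local Notation size_of u N := `|D01 (W (mkseq (letters w u) N)) 0|.
Local Notation c := (expR (- Ct) * d).

Let U0 : (0 : R) \in `[0, 1]. Proof. by rewrite in_itv /= lexx ler01. Qed.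
Let c_gt0 : 0 < c. Proof. by rewrite mulr_gt0// expR_gt0. Qed.

Lemma point_of_first_difference (u v : space) j :
  (forall i, (i < j)%N -> u i = v i) -> u j != v j ->
  c * size_of u j <= `|point_of w u - point_of w v|.
Proof.
move=> uv uvj; rewrite mulrAC; apply: coded_separated => //; first exact: ltW.
  by move=> i ij; rewrite /letters uv.
exact: gap.
Qed.

(** At the first disagreement the points would already be at least [r] apart. *)
Lemma point_of_separated (u v : space) N r :
  `|point_of w u - point_of w v| < r ->
  (forall j, (j < N)%N -> r <= c * size_of u j) ->
  forall j, (j < N)%N -> u j = v j.
Proof.
move=> uvr hN; elim/ltn_ind => j IH jN; apply/eqP/negP => /negP uvj.
have := hN _ jN; rewrite leNgt (le_lt_trans _ uvr)//.
apply: point_of_first_difference uvj => i ij.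
by apply: IH => //; exact: ltn_trans jN.
Qed.

Lemma point_of_common_prefix (u v : space) N :
  (forall j, (j < N)%N -> u j = v j) ->
  `|point_of w u - point_of w v| <= expR Ct * size_of u N.
Proof.
by move=> uv; apply: coded_common_prefix => // j jN; rewrite /letters uv.
Qed.

Lemma size_of_le u N : size_of u N <= rho ^+ N.
Proof. by rewrite (le_trans (D01_word_le f_ifs _ U0))// size_mkseq. Qed.

Lemma size_of_gt0 u N : 0 < size_of u N.
Proof. by rewrite normr_gt0 (D01_word_neq0 f_ifs). Qed.

Lemma size_ofD u N t : size_of u (N + t) <= expR Ct * size_of u N * rho ^+ t.
Proof.
rewrite mkseqD; have := size_of_cat f_ifs f_dist (mkseq (letters w u) N)
  [seq letters w u i | i <- iota N t].
by rewrite size_map size_iota.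
Qed.

Lemma size_of_small u r : 0 < r -> exists N, size_of u N < r.
Proof.
move=> r0; have /cvgr0Pnorm_lt/(_ r r0)[N _ /(_ N (leqnn N))] :=
  rate_expr_cvg0 f_ifs (w 0%N).
rewrite ger0_norm ?exprn_ge0 ?(rate_ge0 f_ifs (w 0%N))// => h.
by exists N; exact: le_lt_trans (size_of_le _ _) h.
Qed.

(** The gap makes the coding injective, so the preimage of a point lies in cylinders of every length
    [N], of mass at most [wmax ^+ N]. *)
Lemma fiber_non_atomic : non_atomic mu.
Proof.
move=> x; rewrite muE; last exact: measurable_set1.
have [[u ux]|none] := pselect (exists u, point_of w u = x); last first.
  by rewrite (_ : _ @^-1` _ = set0) ?measure0// -subset0 => u ux; apply: none; exists u.
have bound N : (eta (point_of w @^-1` [set x]) <= (wmax ^+ N)%:E)%E.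
  apply: (@le_trans _ _ (eta (cylinder (fun j : 'I_N => u j)))).
    apply: le_measure; rewrite ?inE.
    - by apply: measurable_preimage_point; exact: measurable_set1.
    - exact: measurable_cylinder.
    - move=> v /= vx [j _] /=; elim/ltn_ind: j => j IH; apply/esym/eqP/negP => /negP uvj.
      have : c * size_of u j <= `|point_of w u - point_of w v|.
        by apply: point_of_first_difference uvj => i /IH.
      by rewrite ux vx subrr normr0 leNgt mulr_gt0// size_of_gt0.
  rewrite eta_cylinder lee_fin -[N in wmax ^+ N]card_ord -prodr_const.
  by apply: ler_prod => j _; rewrite wmax_ge ltW.
have wmax_ge0 : 0 <= wmax by apply: le_trans (wmax_ge (w 0%N) ord0); exact: ltW.
have cv : (wmax ^+ N)%:E @[N --> \oo] --> 0%:E.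
  apply/fine_cvgP; split; first exact: nearW.
  by apply: cvg_expr; rewrite ger0_norm.
apply/eqP; rewrite eq_le measure_ge0 andbT.
by apply: (cvge_to_ge cv); exact: nearW.
Qed.

(** The larger ball pulls back into a cylinder of some length [m]. After [t] more letters the
    cylinder codes points within [r], while its mass has dropped by a factor of at least
    [wmin ^+ t]. *)
Lemma fiber_doubling_at_point (t : nat) D :
  expR Ct * expR Ct * rho ^+ t * D <= c -> forall u r, 0 < r ->
  (mu (ball (point_of w u) (D * r)) <=
    (wmin ^- t)%:E * mu (ball (point_of w u) r))%E.
Proof.
move=> tD u r r0.
have [D0|D0] := leP D 0.
  rewrite (_ : ball _ (D * r) = set0) ?measure0 ?mule_ge0 ?lee_fin//.
    by rewrite invr_ge0 exprn_ge0// ltW.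
  by apply/ball0; rewrite pmulr_lle0.
have ex : exists m, c * size_of u m < D * r.
  have [m hm] := size_of_small u (divr_gt0 (mulr_gt0 D0 r0) c_gt0).
  by exists m; rewrite mulrC -ltr_pdivlMr.
(* The first level at which the separation guaranteed by the gap falls below [D * r]: minimality
   bounds the large ball, the inequality at [m] the small one. *)
pose m := ex_minn ex.
have [hm hmin] : c * size_of u m < D * r /\
    (forall j, (j < m)%N -> D * r <= c * size_of u j).
  rewrite /m; case: ex_minnP => i hi imin; split => // j ji.
  by rewrite leNgt; apply/negP => /imin; rewrite leqNgt ji.
have mball s : measurable (point_of w @^-1` ball (point_of w u) s : set space).
  by apply: measurable_preimage_point; exact: measurable_ball.
have big_le : (mu (ball (point_of w u) (D * r)) <=
    eta (cylinder (fun j : 'I_m => u j)))%E.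
  rewrite muE; last exact: measurable_ball.
  apply: le_measure; rewrite ?inE; [exact: mball | exact: measurable_cylinder |].
  by move=> v /= uv j; apply/esym; exact: (point_of_separated uv hmin).
have small_ge : (eta (cylinder (fun j : 'I_(m + t) => u j)) <=
    mu (ball (point_of w u) r))%E.
  rewrite muE; last exact: measurable_ball.
  apply: le_measure; rewrite ?inE; [exact: measurable_cylinder | exact: mball |].
  move=> v uv; rewrite /ball /=.
  have {}uv j : (j < m + t)%N -> u j = v j by move=> jm; rewrite (uv (Ordinal jm)).
  apply: le_lt_trans (point_of_common_prefix uv) _.
  have e0 := expR_gt0 Ct.
  have h1 : expR Ct * size_of u (m + t) <=
      expR Ct * expR Ct * rho ^+ t * size_of u m.
    have := size_ofD u m t; rewrite -(ler_pM2l e0) => /le_trans; apply.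
    by rewrite le_eqVlt; apply/orP; left; apply/eqP; ring.
  apply: le_lt_trans h1 _.
  rewrite -(ltr_pM2r D0) mulrAC [ltRHS]mulrC; apply: le_lt_trans hm.
  by rewrite ler_wpM2r.
apply: le_trans big_le _; apply: (@le_trans _ _
  ((wmin ^- t)%:E * eta (cylinder (fun j : 'I_(m + t) => u j)))%E).
  rewrite !eta_cylinder -EFinM lee_fin big_split_ord /= mulrCA ler_peMr//.
    by rewrite prodr_ge0// => j _; exact: ltW.
  rewrite mulrC ler_pdivlMr ?exprn_gt0// mul1r.
  rewrite -[X in wmin ^+ X]card_ord -prodr_const.
  by apply: ler_prod => j _; rewrite wmin_le ltW.
by apply: lee_pmul => //; rewrite lee_fin invr_ge0 exprn_ge0// ltW.
Qed.

(* A point of the support is approximated, within half of the radius, by coded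
   points; this costs replacing [D] by [2 * D + 1]. *)
Lemma fiber_doubling (t : nat) D : 0 < D ->
  expR Ct * expR Ct * rho ^+ t * (2 * D + 1) <= c ->
  forall x, msupport mu x -> forall r, 0 < r ->
  (mu (ball x (D * r)) <= (wmin ^- t)%:E * mu (ball x r))%E.
Proof.
move=> D0 tD x x_supp r r0.
have r2 : 0 < r / 2 by rewrite divr_gt0.
have [u ux] : exists u, ball x (r / 2) (point_of w u).
  have := x_supp _ r2; rewrite muE; last exact: measurable_ball.
  apply: contraPP => /forallNP none.
  by rewrite (_ : _ @^-1` _ = set0) ?measure0 ?ltxx// -subset0 => u /none.
apply: (@le_trans _ _ (mu (ball (point_of w u) ((2 * D + 1) * (r / 2))))).
  apply: le_measure; rewrite ?inE; try exact: measurable_ball.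
  move=> y; move: ux; rewrite /ball /= => ux xy.
  rewrite -(subrKA x) (le_lt_trans (ler_normD _ _))// distrC.
  have -> : (2 * D + 1) * (r / 2) = r / 2 + D * r by field.
  exact: ltrD.
apply: le_trans (fiber_doubling_at_point tD u r2) _.
apply: lee_pmul => //; first by rewrite lee_fin invr_ge0 exprn_ge0// ltW.
apply: le_measure; rewrite ?inE; try exact: measurable_ball.
move=> y; move: ux; rewrite /ball /= => ux uy.
by rewrite -(subrKA (point_of w u)) (le_lt_trans (ler_normD _ _))// [ltRHS](splitr r) ltrD.
Qed.

End fiber.
End random_coding.

(** * The model *)

Section splitting_weights.
Variables (R : realType) (n k : nat) (tri : 'I_n -> 'I_k.+1 -> 'I_n).
Hypothesis tri0 : forall i, tri i ord0 = i.

(* A small mass [e] is given to every letter [tri i j] with [j != 0], and is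
   taken back from the letter [tri i 0 = i]. *)
Lemma splitting_weights (p : 'I_n -> R) : (forall a, 0 < p a) ->
  exists (q : 'I_n -> R) (wt : 'I_n -> 'I_k.+1 -> R),
  [/\ forall i, 0 < q i, forall i j, 0 < wt i j, forall i, \sum_j wt i j = 1 &
    forall a, \sum_i \sum_j q i * wt i j * (tri i j == a)%:R = p a].
Proof.
(* [c a] counts the occurrences of [a] as a companion, so [c a * e] is the mass that [a] receives in
   that role. *)
move=> p0; pose c a : R := \sum_i \sum_(j | j != ord0) (tri i j == a)%:R.
have c0 a : 0 <= c a by apply: sumr_ge0 => i _; apply: sumr_ge0 => j _; rewrite ler0n.
have [e e0 ep] : exists2 e, 0 < e & forall a, c a * e < p a.
  apply: finite_uniform_gt0 => [a d e ed|a].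
    by apply: le_lt_trans; rewrite ler_wpM2l.
  have c1 : 0 < c a + 1 by rewrite ltr_wpDl.
  exists (p a / (c a + 1)); first by rewrite divr_gt0.
  by rewrite mulrA ltr_pdivrMr// mulrC ltr_pM2l// ltrDl.
(* The joint masses of system and position; [q] is their marginal and [wt] the conditional
   weights. *)
pose m i (j : 'I_k.+1) := if j == ord0 then p i - c i * e else e.
have m0 i j : 0 < m i j by rewrite /m; case: ifP; rewrite ?subr_gt0.
have q0 i : 0 < \sum_j m i j.
  by rewrite (bigD1 ord0)//= ltr_pwDl// sumr_ge0// => j _; exact: ltW.
exists (fun i => \sum_j m i j), (fun i j => m i j / \sum_l m i l); split => //.
- by move=> i j; rewrite divr_gt0.
- by move=> i; rewrite -mulr_suml divff// gt_eqF.
move=> a; transitivity (\sum_i \sum_j m i j * (tri i j == a)%:R).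
  apply: eq_bigr => i _; apply: eq_bigr => j _; congr (_ * _).
  by rewrite mulrC divfK// gt_eqF.
have mE i : \sum_j m i j * (tri i j == a)%:R =
    (p i - c i * e) * (i == a)%:R + e * \sum_(j | j != ord0) (tri i j == a)%:R.
  rewrite (bigD1 ord0)//= tri0 /m eqxx mulr_sumr; congr (_ + _).
  by apply: eq_bigr => j /negbTE ->.
under eq_bigr do rewrite mE.
rewrite big_split /= -mulr_sumr -/(c a) (bigD1 a)//= eqxx mulr1 big1 ?addr0.
  by rewrite [e * _]mulrC subrK.
by move=> i /negbTE ->; rewrite mulr0.
Qed.

Lemma splitting_disintegrate (A : comPzRingType) (p q : 'I_n -> A)
    (wt : 'I_n -> 'I_k.+1 -> A) :
  (forall a, \sum_i \sum_j q i * wt i j * (tri i j == a)%:R = p a) ->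
  forall G : 'I_n -> A,
    \sum_i q i * \sum_j wt i j * G (tri i j) = \sum_a p a * G a.
Proof.
move=> pE G; under [RHS]eq_bigr do rewrite -pE mulr_suml.
rewrite exchange_big /=; apply: eq_bigr => i _.
under [RHS]eq_bigr do rewrite mulr_suml.
rewrite exchange_big /= mulr_sumr; apply: eq_bigr => j _.
rewrite (bigD1 (tri i j))//= eqxx mulr1 big1 ?addr0 ?mulrA//.
by move=> a /negbTE; rewrite eq_sym => ->; rewrite mulr0 mul0r.
Qed.

End splitting_weights.

Lemma dist_perturbation (R : realType) (K m m' y y' z z' : R) :
  `|y| <= K -> `|z| <= K -> m <= `|y' - z'| <= m' ->
  m - 2 * K <= `|y + y' - (z + z')| <= m' + 2 * K.
Proof.
move=> hy hz /andP[h1 h2].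
have -> : y + y' - (z + z') = (y' - z') + (y - z) by ring.
have hyz := ler_normB y z.
have t1 := ler_normD (y' - z') (y - z).
have t2 := lerB_normD (y' - z') (y - z).
by apply/andP; split; lra.
Qed.

(** * Non-integrability of words differing in the last letter *)

Section uni.
Variables (R : realType) (n : nat) (f : 'I_n -> R -> R) (Ct : R).
Hypothesis f_ifs : C2_ifs f.
Hypothesis f_dist : distortion_bound f Ct.
Local Notation rho := (contraction_rate f).
Local Notation L s := (log_abs_deriv (word_map f s)).

(* The last letter is applied first, so the letters before it only contribute
   their distortion times the contraction [rho] of the last one. *)
Lemma uni_last_letter s a b (m m' x : R) : x \in `[0, 1] ->
  m <= `|D01 (log_abs_deriv (f a) \- log_abs_deriv (f b)) x| <= m' ->
  m - 2 * Ct * rho <= `|D01 (L (rcons s a) \- L (rcons s b)) x| <=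
    m' + 2 * Ct * rho.
Proof.
move=> xU; rewrite -[log_abs_deriv (f a)]/(L [:: a]) -[log_abs_deriv (f b)]/(L [:: b]).
rewrite (D01_log_abs_derivB f_ifs [:: a] [:: b] xU).
rewrite (D01_log_abs_derivB f_ifs (rcons s a) (rcons s b) xU) -!cats1.
rewrite (D01_log_abs_deriv_cat f_ifs s [:: a] xU).
rewrite (D01_log_abs_deriv_cat f_ifs s [:: b] xU).
have X c : `|D01 (L s) (word_map f [:: c] x) * D01 (word_map f [:: c]) x| <= Ct * rho.
  rewrite normrM ler_pM//; first by apply: f_dist; exact: word_unit.
  exact: abs_deriv_le.
rewrite -mulrA => h; exact: dist_perturbation (X a) (X b) h.
Qed.

End uni.

Lemma distinguished_triples (R : realType) (n : nat) (f : 'I_n -> R -> R) :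
  separation f -> exists tri : 'I_n -> 'I_3 -> 'I_n,
  [/\ forall i, tri i ord0 = i,
      forall i, distinguished_pair (tri i 1%R) (tri i 2%R) &
      forall i j j', j != j' -> disjoint_images (f (tri i j)) (f (tri i j'))].
Proof.
move=> sep.
have /choice[h hP] : forall k, exists h : 'I_n * 'I_n,
    [/\ distinguished_pair h.1 h.2, disjoint_images (f h.1) (f h.2),
        disjoint_images (f h.1) (f k) & disjoint_images (f h.2) (f k)].
  by move=> k; have [i [i' ii']] := sep k; exists (i, i').
exists (fun i => tnth [tuple i; (h i).1; (h i).2]); split=> [i|i|i j j'].
- by [].
- by have [] := hP i.
have sym g g' : disjoint_images g g' -> disjoint_images g' g :> Prop.
  by rewrite /disjoint_images setIC.
have [_ h12 h1 h2] := hP i.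
by case: j => -[|[|[|//]]] /= ?; case: j' => -[|[|[|//]]] //= ? _;
  rewrite !(tnth_nth i) /=; first [exact: h12 | exact: h1 | exact: h2 | apply: sym; assumption].
Qed.

Section triple_model.
Variables (R : realType) (n : nat) (f : 'I_n.+1 -> R -> R).
Hypothesis f_ifs : C2_ifs f.
Variables (tri : 'I_n.+1 -> 'I_3 -> 'I_n.+1) (q : 'I_n.+1 -> R).
Variable wt : 'I_n.+1 -> 'I_3 -> R.
Hypothesis wt_gt0 : forall i j, 0 < wt i j.
Hypothesis wt_sum : forall i, \sum_j wt i j = 1.
Variable Q : probability (omega_space n) R.
Hypothesis Qq : product_measure (fun=> q) Q.
Hypothesis q_sum : \sum_i q i = 1.

(** [br] is one less than the number of maps, so the constant 2 means three maps everywhere; all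
    fibers then share one space of infinite words. *)
Definition triple_model : model R :=
  @Model R n (fun=> 2%N) (fun i j => f (tri i j)) wt Q
    (fun i => subfamily_C2_ifs f_ifs (tri i)) (fun i => conj (wt_gt0 i) (wt_sum i))
    (iid_shift_invariant q_sum Qq).

Lemma fword_triple N (w : 'I_N -> index_set triple_model) (u : words w) :
  fword u = word_map f (fin_letters tri w u).
Proof. exact: (word_map_big_ord f (fun j => tri (w j) (u j))). Qed.

Lemma coding_map_triple (w : Omega triple_model) (u : infinite_words w) :
  coding_map u = point_of f tri w u.
Proof.
congr (lim (_ @ \oo)); apply/funext => N.
by rewrite fword_triple mkseq_letters.
Qed.

Lemma model_transfer_triple N (w : {ffun 'I_N -> index_set triple_model})
    (s : R[i]) (g : R -> R[i]) x :
  model_transfer w s g x = \sum_(v : {ffun 'I_N -> 'I_3})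
    (\prod_(j < N) (wt (w j) (v j))%:C%C) *
    (twist s (cocycle (word_map f (fin_letters tri w v)) x) *
     g (word_map f (fin_letters tri w v) x)).
Proof.
rewrite -[RHS]sum_dffun_ffun; apply: eq_bigr => v _.
by rewrite fword_triple /word_weight rmorph_prod mulrA.
Qed.

End triple_model.

(** * Assembly of the model and verification of its properties *)

Theorem theorem2p4 (R : realType) (n : nat) (f : 'I_n -> R -> R)
  (f_ifs : C2_ifs f)
  (f_fix : ~ common_fixed_point f)
  (K : set R) (f_attr : is_attractor f K) (K0 : ~ K 0) (K1 : ~ K 1)
  (Ct : R) (f_dist : distortion_bound f Ct)
  (f_sep : separation f)
  (f_uni : non_integrability f Ct)
  (p : 'I_n -> R) (p_prob : positive_prob_vector p)
  (nu : probability (measurableTypeR R) R) (nu_self : self_conformal f p nu) :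
  exists (M : model R) (mu : Omega M -> probability (measurableTypeR R) R),
  [/\ forall w, is_mu w (mu w),
      nontrivial_model mu,
      bernoulli_model M &
      forall (i : index_set M) (j : 'I_(nmaps i)), exists a, maps j = f a] /\
  [/\ forall A : set R, measurable A ->
        measurable_fun [set: Omega M] (fun w => mu w A) /\
        nu A = (\int[law M]_w mu w A)%E,
      forall (N : nat) (s : R[i]) (g : R -> R[i]), C1_complex g ->
        forall x, x \in `[0, 1] ->
          iter N (transfer f p s) g x =
          \sum_(w : {ffun 'I_N -> index_set M})
             (fine (law M (cylinder w)))%:C%C * model_transfer w s g x,
      forall i : index_set M, nmaps i = 2%N \/ nmaps i = 3%N,
      forall w : Omega M,
        trivIset setT
          (fun u : words (initial_word 1 w) => fword u @` unit_itv R) &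
      (exists m m' : R, exists N0 : nat, [/\ 0 < m, 0 < m' &
        forall N, (N0 <= N)%N -> forall w : Omega M,
          exists alpha1 alpha2 : words (initial_word N w),
            forall x, x \in `[0, 1] ->
              m <= `|D01 (log_abs_deriv (fword alpha1) \-
                          log_abs_deriv (fword alpha2)) x| <= m']) /\
      (forall D : R, 1 < D -> exists2 C : R, 0 < C &
        forall (w : Omega M) (x : R), msupport (mu w) x ->
          forall r : R, 0 < r ->
            (mu w (ball x (D * r)) <= C%:E * mu w (ball x r))%E)].
Proof.
case: n f f_ifs f_fix f_attr f_dist f_sep f_uni p p_prob nu_self => [|n] f f_ifs _ _ f_dist f_sep f_uni p p_prob nu_self.
  by case: p_prob => _ /eqP; rewrite big_ord0 eq_sym oner_eq0.
have [tri [tri0 tri12 tri_disj]] := distinguished_triples f_sep.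
have [p_gt0 p_sum] := p_prob.
have [q [wt [q_gt0 wt_gt0 wt_sum qwt]]] := splitting_weights tri0 p_gt0.
have p_ge0 a : 0 <= p a by exact: ltW.
have disint := splitting_disintegrate qwt.
(* The one-letter identity applied to the constant 1. *)
have q_sum : \sum_i q i = 1.
  rewrite -p_sum -[RHS](eq_bigr _ (fun a _ => mulr1 (p a))) -disint.
  by apply: eq_bigr => i _; rewrite -mulr_suml wt_sum !mulr1.
have [Q Qq] := product_measure_exists (fun _ => q_gt0) (fun _ => q_sum) .
pose M := triple_model f_ifs tri wt_gt0 wt_sum Qq q_sum.
have eta_ex (w : Omega M) := product_measure_exists (fun j => wt_gt0 (w j)) (fun j => wt_sum (w j)).
have /choice[mu muP] (w : Omega M) : exists mu : probability (measurableTypeR R) R,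
    exists2 eta : probability (product_space (fun=> 2%N)) R,
      product_measure (fun j => wt (w j)) eta &
      forall A, measurable A -> mu A = eta (point_of f tri w @^-1` A).
  have [eta etaP] := eta_ex w.
  have mX : measurable_fun [set: product_space (fun=> 2%N)]
      (point_of f tri w : _ -> measurableTypeR R).
    by move=> mT A mA; exact: (measurable_point_of f_ifs).
  pose X : {mfun product_space (fun=> 2%N) >-> measurableTypeR R} :=
    HB.pack (point_of f tri w : _ -> measurableTypeR R) (isMeasurableFun.Build _ _ _ _ _ mX).
  by exists (distribution eta X), eta.
have [d d_gt0 gap] : exists2 d, 0 < d & forall i j j', j != j' ->
    forall x y, x \in `[0, 1] -> y \in `[0, 1] -> d <= `|f (tri i j) x - f (tri i j') y|.
  have [|t|d d0 h] := @finite_uniform_gt0 R ('I_n.+1 * 'I_3 * 'I_3)%type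
    (fun t d => t.1.2 != t.2 -> forall x y, x \in `[0, 1] -> y \in `[0, 1] ->
      d <= `|f (tri t.1.1 t.1.2) x - f (tri t.1.1 t.2) y|).
  - by move=> t d e ed h tt x y xU yU; exact: le_trans ed (h tt x y xU yU).
  - have [tt|tt] := eqVneq t.1.2 t.2; first by exists 1.
    by have [d d0 h] := disjoint_images_gap f_ifs (tri_disj t.1.1 _ _ tt); exists d.
  - by exists d => // i j j' jj'; exact: (h (i, j, j')).
have [wmin wmin_gt0 wmin_le] : exists2 m, 0 < m & forall i j, m <= wt i j.
  have [|t|m m0 h] := @finite_uniform_gt0 R ('I_n.+1 * 'I_3)%type (fun t m => m <= wt t.1 t.2).
  - by move=> t d' e; exact: le_trans.
  - by exists (wt t.1 t.2).
  - by exists m => // i j; exact: (h (i, j)).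
have wmax_lt1 : 1 - wmin < 1 by rewrite ltrBlDr ltrDl.
have wmax_ge i j : wt i j <= 1 - wmin.
  (* Another of the three letters takes at least [wmin] of the total mass. *)
  have [j' jj'] : exists j' : 'I_3, j' != j.
    by have [->|j0] := eqVneq j ord0; [exists 1%R | exists ord0; rewrite eq_sym].
  rewrite lerBrDr -(wt_sum i) (bigD1 j)//= lerD2l (bigD1 j')//=.
  by rewrite (le_trans (wmin_le i j'))// lerDl sumr_ge0// => l _; exact: ltW.
have U0 : (0 : R) \in `[0, 1] by rewrite in_itv /= lexx ler01.
have rho_ge0 := rate_ge0 f_ifs ord0.
have Ct_ge0 := distortion_ge0 f_dist.
exists M, mu; split; split.
- move=> w; have [eta etaP muE] := muP w; exists eta => // A mA.
  rewrite muE//; congr (eta _); apply/seteqP; split=> u /=; first by rewrite -[point_of _ _ _ _]coding_map_triple.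
  by rewrite -[point_of _ _ _ _]coding_map_triple.
- apply: aeW => w; have [eta etaP muE] := muP w.
  exact: (fiber_non_atomic f_ifs f_dist wt_gt0 etaP muE d_gt0 gap wmax_lt1 wmax_ge).
- by exists q => //; split=> // i; exact: ltW.
- by move=> i j; exists (tri i j).
(* The tail sum as a function of a finite word, whose integral is then a finite sum of cylinder
   masses. *)
- pose H (t : R) N (w : 'I_N -> 'I_n.+1) : R := \sum_(v : {ffun 'I_N -> 'I_3})
    (\prod_j wt (w j) (v j)) * (t < word_map f (fin_letters tri w v) 0)%R%:R.
  have H_ge0 t N w : 0 <= H t N w.
    apply: sumr_ge0 => v _; rewrite mulr_ge0 ?ler0n//.
    by apply: prodr_ge0 => j _; exact: ltW.
  have tailE t N (w : Omega M) : tail_sum f tri wt w N t = H t N (restr N w).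
    apply: eq_bigr => v _; congr (_ * (_ < word_map f _ 0)%R%:R).
      by apply: eq_bigr => j _; rewrite ffunE.
    by apply: eq_map => j; rewrite /= ffunE.
  apply: (@mixture_of_tail_approx _ (fun N => contraction_rate f ^+ N) _ _ _ _ (Omega M)
    (law M) mu nu (tail_sum f tri wt)
    (fun N t => word_sum p N (fun s => (t < word_map f s 0)%R%:R))).
  + by move=> N; exact: exprn_ge0.
  + by apply/nonincreasing_seqP => N; rewrite exprSr ler_piMr ?exprn_ge0// ltW// rate_lt1.
  + exact: rate_expr_cvg0 f_ifs ord0.
  + by move=> w N t; rewrite tailE.
  + by move=> w; have [eta etaP muE] := muP w; exact: (fiber_tail_approx f_ifs etaP muE).
  + exact: self_conformal_tail_approx.
  + move=> N t; rewrite (_ : (fun w => _) = (fun w : Omega M => H t N (restr N w))).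
      exact: (@measurable_fun_restr (fun=> n) N _ R (fun w => H t N w)).
    by apply/funext => w; rewrite tailE.
  + move=> N t; under eq_integral do rewrite tailE.
    rewrite (integral_restr Qq (G := fun w => H t N w))//; congr _%:E.
    rewrite -(word_sum_disintegrate disint).
    exact: (@sum_dffun_ffun _ _ _ (fun w : {ffun 'I_N -> 'I_n.+1} => (\prod_j q (w j)) * H t N w)).
- have disintC := @splitting_disintegrate _ _ tri R[i] (fun a => (p a)%:C%C)
    (fun i => (q i)%:C%C) (fun i j => (wt i j)%:C%C).
  move=> N s g _ x xU; rewrite (iter_transfer p f_ifs)//.
  rewrite -(word_sum_disintegrate (disintC _)); last first.
    move=> a; rewrite -qwt rmorph_sum; apply: eq_bigr => i _.
    by rewrite rmorph_sum; apply: eq_bigr => j _; rewrite !rmorphM /= rmorph_nat.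
  apply: eq_bigr => w _; rewrite model_transfer_triple; congr (_ * _).
  by rewrite [law M _](Qq N w) /= rmorph_prod.
- by move=> i; right.
- move=> w; apply/trivIsetP => u u' _ _ uu'; rewrite !fword_triple.
  have enum1 : enum 'I_1 = [:: ord0] by rewrite enum_ordSl (size0nil (size_enum_ord 0)).
  rewrite /fin_letters enum1 /=.
  have uu0 : u ord0 != u' ord0.
    by apply: contra uu' => /eqP uu0; apply/eqP/ffunP => j; rewrite [j]ord1.
  exact: tri_disj uu0.
split.
  have [m [m' [m0 m'0 hm hgap]]] := f_uni.
  (* [N0] is 1 because a last letter is needed; positivity of the lower constant is part of the
     non-integrability assumption. *)
  exists (m - 2 * Ct * contraction_rate f), (m' + 2 * Ct * contraction_rate f), 1%N.
  split=> //; first by rewrite ltr_wpDr// !mulr_ge0.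
  move=> [//|N] _ w.
  (* Both words use position 0 throughout, except at the last place, where positions 1 and 2 select
     the distinguished pair. *)
  pose alpha (c : 'I_3) : words (initial_word N.+1 w) :=
    [ffun j : 'I_N.+1 => if j == ord_max then c else ord0].
  pose s := [seq tri (w j) ord0 | j : 'I_N <- enum 'I_N].
  have alphaE c : fword (alpha c) = word_map f (rcons s (tri (w N) c)).
    rewrite fword_triple /fin_letters enum_ordSr map_rcons -map_comp.
    rewrite ffunE eqxx; congr (word_map f (rcons _ _)); apply: eq_map => j /=.
    by rewrite ffunE ifF//; apply/negP => /eqP/(congr1 val)/=; apply/eqP; rewrite ltn_eqF.
  exists (alpha 1%R), (alpha 2%R) => x xU; rewrite !alphaE.
  by apply: (uni_last_letter f_ifs f_dist) => //; exact: hm.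
move=> D D1; have D0 : 0 < D by exact: lt_trans D1.
have e0 := expR_gt0 Ct.
have K0' : 0 < expR Ct * expR Ct * (2 * D + 1).
  by rewrite !mulr_gt0// addr_gt0// mulr_gt0.
have c0 : 0 < expR (- Ct) * d by rewrite mulr_gt0// expR_gt0.
(* The number [t] of extra letters depends on [D] and on constants of the system, but not on [w];
   hence so does [wmin ^- t]. *)
have /cvgr0Pnorm_lt/(_ _ (divr_gt0 c0 K0'))[t _ /(_ t (leqnn t))] := rate_expr_cvg0 f_ifs ord0.
rewrite ger0_norm ?exprn_ge0// ltr_pdivlMr// => /ltW ht.
exists (wmin ^- t); first by rewrite invr_gt0 exprn_gt0.
move=> w x xsupp r r0; have [eta etaP muE] := muP w.
apply: (fiber_doubling f_ifs f_dist wt_gt0 etaP muE d_gt0 gap wmin_gt0 wmin_le D0 _ xsupp r0).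
by apply: le_trans ht; rewrite le_eqVlt; apply/orP; left; apply/eqP; ring.
Qed.
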